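(* Let $n\ge1$ and let $A,B$ be convex bodies in $\mathbb{R}^n$ such that for every $1\le k\le n$, every $k$-dimensional linear subspace $E$ of $\mathbb{R}^n$ and every unit vector $u\in E$, $$\frac{|P_E(A+B)|_k}{|P_{E\cap u^\perp}(A+B)|_{k-1}}\ge\frac{|P_EA|_k}{|P_{E\cap u^\perp}A|_{k-1}}.$$ Then for every zonoid $Z$ in $\mathbb{R}^n$, $$|A|\,|A+B+Z|\le|A+B|\,|A+Z|.$$
   Context: $P_F$ denotes orthogonal projection onto a linear subspace $F$, $u^\perp$ is the hyperplane orthogonal to $u$, $|\cdot|_k$ is $k$-dimensional volume (with $|\cdot|_0$ of a point equal to $1$), and $|\cdot|=|\cdot|_n$. $+$ is Minkowski addition; a convex body is a compact convex set with nonempty interior. A zonotope is a Minkowski sum of finitely many line segments; a zonoid is a limit of zonotopes in the Hausdorff metric. *)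

(* Defs.v *)
From HB Require Import structures.
From mathcomp Require Import all_boot all_order all_algebra.
From mathcomp Require Import all_classical all_reals all_analysis.
Set Implicit Arguments. Unset Strict Implicit. Unset Printing Implicit Defensive.
Import Order.TTheory GRing.Theory Num.Theory.
Import numFieldNormedType.Exports.
Local Open Scope classical_set_scope.
Local Open Scope ring_scope.

Section Defs.
Variable R : realType.

Definition dotv n (x y : 'rV[R]_n) : R := \sum_(i < n) x 0 i * y 0 i.

Definition minksum n (A B : set 'rV[R]_n) : set 'rV[R]_n :=
  [set x | exists a b, A a /\ B b /\ x = a + b].

Definition convex_set n (A : set 'rV[R]_n) : Prop :=
  forall x y, A x -> A y -> forall t : R, 0 <= t <= 1 -> A (t *: x + (1 - t) *: y).

Definition convex_body n (A : set 'rV[R]_n) : Prop :=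
  compact A /\ convex_set A /\ (A° !=set0).

Definition segment n (a b : 'rV[R]_n) : set 'rV[R]_n :=
  [set x | exists t : R, 0 <= t <= 1 /\ x = (1 - t) *: a + t *: b].

Definition zonotope n (Z : set 'rV[R]_n) : Prop :=
  exists s : seq ('rV[R]_n * 'rV[R]_n),
    Z = foldr (fun p S => minksum (segment p.1 p.2) S) [set 0] s.

Definition eball n (e : R) : set 'rV[R]_n := [set x | dotv x x <= e ^+ 2].

Definition hausdorff_le n (K L : set 'rV[R]_n) (e : R) : Prop :=
  K `<=` minksum L (@eball n e) /\ L `<=` minksum K (@eball n e).

Definition zonoid n (Z : set 'rV[R]_n) : Prop :=
  compact Z /\ Z !=set0 /\
  exists Y : nat -> set 'rV[R]_n, (forall m, zonotope (Y m)) /\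
    forall e : R, 0 < e -> exists N, forall m, (N <= m)%N -> hausdorff_le (Y m) Z e.

(* Lebesgue (outer) measure on R^k via countable covers by closed boxes;
   a cover entry None stands for the empty set (needed for k = 0, where
   the measure is the unit point mass). *)
Definition box k (a b : 'rV[R]_k) : set 'rV[R]_k :=
  [set x | forall i, a 0 i <= x 0 i <= b 0 i].
Definition boxvol k (a b : 'rV[R]_k) : R := \prod_(i < k) Num.max (b 0 i - a 0 i) 0.
Definition obox_set k (o : option ('rV[R]_k * 'rV[R]_k)) : set 'rV[R]_k :=
  if o is Some p then box p.1 p.2 else set0.
Definition obox_vol k (o : option ('rV[R]_k * 'rV[R]_k)) : R :=
  if o is Some p then boxvol p.1 p.2 else 0.
Definition lebesgue_outer k (S : set 'rV[R]_k) : \bar R :=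
  ereal_inf [set (\sum_(0 <= j <oo) (obox_vol (c j))%:E)%E
            | c in [set c : nat -> option ('rV[R]_k * 'rV[R]_k)
                   | S `<=` \bigcup_j obox_set (c j)]].

Definition vol n (K : set 'rV[R]_n) : \bar R := lebesgue_outer K.

(* |P_E K|_k where F : 'M_(k,n) has orthonormal rows spanning E:
   the coordinates x *m F^T identify E isometrically with R^k. *)
Definition projvol k n (F : 'M[R]_(k, n)) (K : set 'rV[R]_n) : \bar R :=
  lebesgue_outer [set x *m F^T | x in K].

Definition orthonormal_rows k n (F : 'M[R]_(k, n)) : Prop := F *m F^T = 1%:M.

End Defs.

(* Main.v *)
From Pilot Require Import Defs.
From HB Require Import structures.
From mathcomp Require Import all_boot all_order all_algebra.
From mathcomp Require Import finmap.
From mathcomp Require Import all_classical all_reals all_analysis.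
From mathcomp Require Import ring lra zify.
Set Implicit Arguments. Unset Strict Implicit. Unset Printing Implicit Defensive.
Import Order.TTheory GRing.Theory Num.Theory.
Import numFieldNormedType.Exports.
(* [all_analysis] also defines a [convex_set]; the one of [Defs] is meant. *)
Import Pilot.Defs.
Local Open Scope classical_set_scope.
Local Open Scope ring_scope.

(** For a segment [S] of direction [v] in a subspace [E] of dimension [k], a
    convex body [K] satisfies [|P_E (K + S)| = |P_E K| + |P_E v| |P_F K|], where
    [F] is the orthogonal complement of [P_E v] in [E].  By induction on the
    number of segments of a zonotope [Y], with [r > 0] fixed and for all
    subspaces [E] at once, this and the ratio hypothesis give
    [|P_E A| |P_E (r (A + B) + Y)| <= |P_E (A + B)| |P_E (r A + Y)|].
    If [Y] is close to the zonoid [Z] then [A + B + Z] lies in a translate of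
    [(1 + d) (A + B) + Y], while [(1 + d) A + Y] lies in a small neighbourhood
    of [A + Z]; so the case [r = 1 + d] yields the theorem as [d -> 0].

    The volume of a compact set is the limit of the number of cells of the grid
    of step [h] that it meets, times [h^k].  For a segment along a coordinate
    axis whose length is a multiple of [h], the volume formula is an exact
    identity between numbers of cells, because a convex set meets each column of
    cells in a run of consecutive ones.  Rotation invariance reduces the general
    segment to this case. *)

(** * Counting grid cells *)

(** [fset_set] of an infinite set is empty, so the count means something for finite sets only. *)
Definition ncard (T : choiceType) (A : set T) : nat := #|` fset_set A|.

Lemma leq_ncard (T : choiceType) (A B : set T) :
  finite_set B -> A `<=` B -> (ncard A <= ncard B)%N.
Proof.
move=> fB AB; apply: fsubset_leq_card.
by rewrite -fset_set_sub //; exact: sub_finite_set fB.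
Qed.

Lemma ncardU_le (T : choiceType) (A B : set T) :
  finite_set A -> finite_set B -> (ncard (A `|` B) <= ncard A + ncard B)%N.
Proof. by move=> fA fB; rewrite /ncard fset_setU // cardfsU leq_subr. Qed.

Lemma ncardU (T : choiceType) (A B : set T) :
  finite_set A -> finite_set B -> A `&` B = set0 ->
  ncard (A `|` B) = (ncard A + ncard B)%N.
Proof.
move=> fA fB AB; rewrite /ncard fset_setU // cardfsU -fset_setI // AB.
by rewrite fset_set0 cardfs0 subn0.
Qed.

Lemma ncard_image (T U : choiceType) (f : T -> U) (A : set T) :
  finite_set A -> {in A &, injective f} -> ncard (f @` A) = ncard A.
Proof.
move=> fA fI; rewrite /ncard fset_set_image // card_in_imfset // => x y.
by rewrite !in_fset_set //; exact: fI.
Qed.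

Lemma ncard_range (T : finType) (U : choiceType) (f : T -> U) (A : set U) :
  A `<=` range f -> finite_set A /\ (ncard A <= #|T|)%N.
Proof.
move=> Af; have Af' : A `<=` [set` [fset f x | x in T]%fset].
  by move=> y /Af [x _ <-]; rewrite /= in_imfset.
split; first exact: sub_finite_set Af' (finite_fset _).
apply: (leq_trans (leq_ncard (finite_fset _) Af')).
by rewrite /ncard set_fsetK (leq_trans (leq_imfset_card _ _ _)) //= -cardE.
Qed.

Lemma ncard_int_box k (lo : 'I_k -> int) (n : 'I_k -> nat) (A : set 'rV[int]_k) :
  (forall z, A z -> forall i, lo i <= z 0 i < lo i + (n i)%:Z) ->
  finite_set A /\ (ncard A <= \prod_i n i)%N.
Proof.
move=> bA.
pose f (g : {dffun forall i : 'I_k, 'I_(n i)}) : 'rV[int]_k :=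
  \row_i (lo i + (g i : nat)%:Z).
have Af : A `<=` range f.
  move=> z Az.
  have zn i : (`|(z 0 i - lo i)%R| < n i)%N by have := bA z Az i; lia.
  exists [ffun i => Ordinal (zn i)] => //.
  by apply/rowP => i; rewrite mxE ffunE /=; have := bA z Az i; lia.
have [fA cA] := ncard_range Af; split=> //; apply: leq_trans cA _.
rewrite card_dep_ffun foldrE big_map big_enum /=.
by under eq_bigr do rewrite card_ord.
Qed.

Section Grid.
Variable R : realType.

(* [h]-grid: the half-open cell with index [z] is [h z + [0, h)^k]. *)
Definition cell k (h : R) (x : 'rV[R]_k) : 'rV[int]_k :=
  \row_i Num.floor (x 0 i / h).

Definition gridvol k (h : R) (S : set 'rV[R]_k) : R :=
  h ^+ k * (ncard (cell h @` S))%:R.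

Definition thicken k (r : R) (S : set 'rV[R]_k) : set 'rV[R]_k :=
  [set x | exists2 y, S y & forall i, `|x 0 i - y 0 i| <= r].

Lemma cellP k (h : R) (x : 'rV[R]_k) z : 0 < h ->
  cell h x = z <-> forall i, (z 0 i)%:~R * h <= x 0 i < (z 0 i)%:~R * h + h.
Proof.
move=> h0; split=> [<- i|H].
  rewrite mxE; have /andP[] := floor_itv (x 0 i / h).
  rewrite intrD ler_pdivlMr // ltr_pdivrMr // mulrDl mul1r => -> -> //.
apply/rowP => i; rewrite mxE; apply: floor_def.
by rewrite intrD ler_pdivlMr // ltr_pdivrMr // mulrDl mul1r.
Qed.

(** An interval of length [l] meets at most [l / h + 2] half-open intervals of the grid; times [h]
    this is a factor [l + 2 h] per coordinate. *)
Lemma gridvol_box k (h : R) (a l : 'I_k -> R) (S : set 'rV[R]_k) :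
  0 < h -> (forall i, 0 <= l i) ->
  (forall x, S x -> forall i, a i <= x 0 i <= a i + l i) ->
  finite_set (cell h @` S) /\ gridvol h S <= \prod_i (l i + 2 * h).
Proof.
move=> h0 l0 bS.
pose lo i := Num.floor (a i / h); pose hi i := Num.floor ((a i + l i) / h).
have lohi i : lo i <= hi i.
  by apply: le_floor; rewrite ler_pdivrMr // divfK ?lt0r_neq0 // lerDl.
have [fA cA] : finite_set (cell h @` S) /\
    (ncard (cell h @` S) <= \prod_i `|(hi i - lo i + 1)%R|)%N.
  apply: (@ncard_int_box k lo) => z [x Sx <-] i; rewrite mxE.
  have /andP[ax xb] := bS x Sx i.
  have : lo i <= Num.floor (x 0 i / h).
    by apply: le_floor; rewrite ler_pdivrMr // divfK ?lt0r_neq0.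
  have : Num.floor (x 0 i / h) <= hi i.
    by apply: le_floor; rewrite ler_pdivrMr // divfK ?lt0r_neq0.
  by lia.
split=> //; rewrite /gridvol.
apply: (@le_trans _ _ (h ^+ k * (\prod_i `|(hi i - lo i + 1)%R|)%N%:R)).
  by rewrite ler_pM2l ?exprn_gt0 // ler_nat.
have -> : h ^+ k = \prod_(i < k) h by rewrite prodr_const card_ord.
rewrite natr_prod -big_split /=; apply: ler_prod => i _.
rewrite mulr_ge0 ?(ltW h0) //=.
have -> : (`|(hi i - lo i + 1)%R|%N)%:R = (hi i)%:~R - (lo i)%:~R + 1 :> R.
  rewrite -[1 in RHS]/(1%:~R) -rmorphB -rmorphD /= pmulrn; congr (_%:~R).
  by have := lohi i; lia.
have := floor_le ((a i + l i) / h); have := floor_itv (a i / h).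
rewrite -/(lo i) -/(hi i) intrD ler_pdivlMr // ltr_pdivrMr // ler_pdivlMr //.
by case/andP => _; lra.
Qed.

(** Continuity of a finite product: a box can be enlarged at an arbitrarily small cost in volume. *)
Lemma prod_shift_le k (c : 'I_k -> R) (e : R) : 0 < e ->
  exists2 d, 0 < d & \prod_i (c i + d) <= \prod_i c i + e.
Proof.
move=> e0.
have : (\prod_i (c i + d)) @[d --> 0^'+] --> \prod_i c i.
  elim: (index_enum _) => [|i s IH].
    by rewrite big_nil; under eq_fun do rewrite big_nil; exact: cvg_cst.
  rewrite big_cons; under eq_fun do rewrite big_cons.
  apply: cvgM => //; rewrite -[X in _ --> X]addr0; apply: cvgD; first exact: cvg_cst.
  exact/cvg_at_right_filter/cvg_id.
move=> /cvgr_le -/(_ (\prod_i c i + e)).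
rewrite ltrDl => /(_ e0) H.
have [d [d0 Hd]] : exists d, 0 < d /\ \prod_i (c i + d) <= \prod_i c i + e.
  have : \forall d \near 0^'+, 0 < d /\ \prod_i (c i + d) <= \prod_i c i + e.
    by apply: filterS2 (nbhs_right_gt (0 : R)) H => d.
  exact: filter_ex.
by exists d.
Qed.

End Grid.

(** * Lebesgue outer measure and grids *)

Lemma ncard_bigcup (T : choiceType) N (B : 'I_N -> set T) (A : set T) :
  (forall i, finite_set (B i)) -> A `<=` \bigcup_i B i ->
  finite_set A /\ (ncard A <= \sum_i ncard (B i))%N.
Proof.
move=> fB AB.
have [fU cU] : finite_set (\big[setU/set0]_i B i) /\
    (ncard (\big[setU/set0]_i B i) <= \sum_i ncard (B i))%N.
  elim: (index_enum _) => [|i s [f1 c1]].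
    by rewrite !big_nil; split=> //; rewrite /ncard fset_set0.
  rewrite !big_cons; split; first by rewrite finite_setU.
  by apply: leq_trans (ncardU_le (fB i) f1) _; rewrite leq_add2l.
have AB' : A `<=` \big[setU/set0]_i B i.
  by move=> x /AB [i _ Bix]; rewrite (bigD1 i) //=; left.
by split; [exact: sub_finite_set fU|exact: leq_trans (leq_ncard fU AB') cU].
Qed.

Section Outer.
Variable R : realType.
Local Open Scope ereal_scope.

Lemma obox_vol_ge0 k (o : option ('rV[R]_k * 'rV[R]_k)) : (0 <= obox_vol o)%R.
Proof.
by case: o => [[a b]|] //=; apply: prodr_ge0 => i _; rewrite le_max lexx orbT.
Qed.

Lemma outer_ge0 k (S : set 'rV[R]_k) : 0 <= lebesgue_outer S.
Proof.
apply: le_ereal_inf_tmp => _ [c _ <-]; apply: nneseries_ge0 => n _ _.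
by rewrite lee_fin obox_vol_ge0.
Qed.

Lemma le_outer k (S T : set 'rV[R]_k) : S `<=` T ->
  lebesgue_outer S <= lebesgue_outer T.
Proof.
move=> ST; apply: ereal_inf_le_tmp => _ [c Tc <-]; exists c => //.
exact: subset_trans Tc.
Qed.

(** The closures of the cells met by [S] cover it. The cover lists these boxes and continues with
    [None], of volume 0. *)
Lemma outer_le_gridvol k (h : R) (S : set 'rV[R]_k) : (0 < h)%R ->
  finite_set (cell h @` S) -> lebesgue_outer S <= (gridvol h S)%:E.
Proof.
move=> h0 fS; set F := fset_set (cell h @` S).
pose s : seq (option ('rV[R]_k * 'rV[R]_k)) :=
  [seq Some (h *: map_mx intr z, h *: map_mx intr z + const_mx h)%R | z <- F].
have sz : size s = ncard (cell h @` S) by rewrite size_map.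
apply: ereal_inf_lbound; exists (nth None s).
  move=> x Sx.
  have zF : cell h x \in F by rewrite in_fset_set // inE; exists x.
  exists (index (cell h x) F) => //.
  rewrite /s (nth_map (cell h x)) ?index_mem // nth_index //= => i.
  have /(_ i) := (cellP x (cell h x) h0).1 erefl; rewrite !mxE mulrC.
  by case/andP => -> /ltW ->.
rewrite (@nneseries_split _ _ 0 (size s)); last first.
  by move=> n _; rewrite lee_fin obox_vol_ge0.
rewrite eseries0 ?adde0; last by move=> i /[!add0n] si _; rewrite nth_default.
rewrite add0n sumEFin /gridvol -sz; congr EFin.
rewrite big_nat (eq_bigr (fun=> h ^+ k)%R); last first.
  move=> i /andP[_ si]; rewrite size_map in si.
  rewrite /s (nth_map 0%R) //= /boxvol.
  rewrite (eq_bigr (fun=> h)) ?prodr_const ?card_ord // => j _.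
  by rewrite !mxE addrAC subrr add0r max_l // ltW.
by rewrite -big_nat sumr_const_nat subn0 mulr_natr.
Qed.

(** The boxes of a nearly optimal cover are enlarged and compactness keeps finitely many of them.
    For a step [h] below all margins, the [h]-neighbourhood of [S] stays inside these, where
    [gridvol_box] bounds the number of cells. *)
Lemma gridvol_thicken_le k (S : set 'rV[R]_k) (e : R) : compact S -> (0 < e)%R ->
  lebesgue_outer S \is a fin_num ->
  exists2 d, (0 < d)%R & forall h, (0 < h <= d)%R ->
    finite_set (cell h @` thicken h S) /\
    (gridvol h (thicken h S))%:E <= lebesgue_outer S + e%:E.
Proof.
move=> cS e0 fS.
have e20 : (0 < e / 2)%R by rewrite divr_gt0.
have [_ [c Sc <-] cS'] := lb_ereal_inf_adherent e20 fS.
(* The extra costs of the boxes sum to [e / 2]; the other half of [e] pays for the choice of [c]. *)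
pose w j := (obox_vol (c j) + e / 2 / (2 ^ j.+1)%:R)%R.
(* [6 d] consists of [2 d] on either side of the box, one [d] for compactness and one for the
   thickening by [h <= d], and of the [2 h] of [gridvol_box]. *)
have /choice[dl dlP] : forall j, exists d, (0 < d)%R /\ forall p, c j = Some p ->
    (\prod_i (Num.max (p.2 0 i - p.1 0 i) 0 + 6 * d) <= w j)%R.
  move=> j; rewrite /w; case: (c j) => [p|]; last by exists 1%R.
  have ej : (0 < e / 2 / (2 ^ j.+1)%:R)%R by rewrite divr_gt0 // ltr0n expn_gt0.
  have [d d0 dP] := prod_shift_le (fun i => Num.max (p.2 0%R i - p.1 0%R i) 0)%R ej.
  exists (d / 6)%R; split; first by rewrite divr_gt0.
  by move=> q [<-] /=; rewrite mulrC divfK.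
pose P N (x : 'rV[R]_k) := exists j p, [/\ (j < N)%N, c j = Some p &
  forall i, (p.1 0 i - dl j <= x 0 i <= p.2 0 i + dl j)%R].
(* A point of box [j] has its ball of radius [dl j] inside the enlarged box, so compactness bounds
   the indices needed. *)
have [N SN] : exists N, S `<=` P N.
  have /compact_near_coveringP /(_ nat \oo P _) nc := cS.
  suff : \forall N \near \oo, S `<=` P N by move/filter_ex.
  apply: nc => x Sx; have [j _] := Sc x Sx.
  case cj : (c j) => [p|] //= bx.
  exists (ball x (dl j), [set N | (j < N)%N]).
    split; first exact: nbhsx_ballx (dlP j).1.
    exact: nbhs_infty_gt.
  move=> [y N] /= [[_ xy] jN]; exists j, p; split=> // i.
  have := xy 0%R i; rewrite /ball /= ltr_norml => /andP[y1 y2].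
  by have /andP[] := bx i; lra.
have [d d0 dN] : exists2 d, (0 < d)%R & forall j, (j < N)%N -> (d <= dl j)%R.
  elim: (N) => [|M [d d0 IH]]; first by exists 1%R.
  exists (Num.min d (dl M)); first by rewrite lt_min d0 (dlP M).1.
  move=> j; rewrite ltnS leq_eqVlt => /orP[/eqP->|/IH jM].
    by rewrite ge_min lexx orbT.
  by rewrite ge_min jM.
exists d => // h /andP[h0 hd].
pose U (j : 'I_N) := [set x : 'rV[R]_k | exists2 p, c j = Some p &
  forall i, (p.1 0 i - 2 * dl j <= x 0 i <= p.2 0 i + 2 * dl j)%R].
have UP (j : 'I_N) : finite_set (cell h @` U j) /\ (gridvol h (U j) <= w j)%R.
  have hj := le_trans hd (dN j (ltn_ord j)).
  have dl0 := (dlP j).1.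
  case cj : (c j) => [p|]; last first.
    have -> : U j = set0 by apply/seteqP; split=> // x [p]; rewrite cj.
    rewrite image_set0; split=> //; rewrite /gridvol image_set0 /ncard fset_set0 mulr0.
    by rewrite /w addr_ge0 ?obox_vol_ge0 // divr_ge0 // ltW.
  have [|x [q]|H1 H2] := @gridvol_box R k h (fun i => p.1 0 i - 2 * dl j)%R
    (fun i => Num.max (p.2 0 i - p.1 0 i) 0 + 4 * dl j)%R (U j) h0.
  - by move=> i; rewrite addr_ge0 ?mulr_ge0 ?(ltW dl0) // le_max lexx orbT.
  - rewrite cj => -[<-] bx i; have /andP[-> /=] := bx i.
    have : (p.2 0 i - p.1 0 i <= Num.max (p.2 0 i - p.1 0 i) 0)%R by rewrite le_max lexx.
    by lra.
  split=> //; apply: (le_trans H2); apply: le_trans ((dlP j).2 p cj).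
  apply: ler_prod => i _.
  have : (0 <= Num.max (p.2 0 i - p.1 0 i) 0)%R by rewrite le_max lexx orbT.
  by move=> ?; apply/andP; split; lra.
have SU : cell h @` thicken h S `<=` \bigcup_j (cell h @` U j).
  move=> _ [x [y /SN [j [p [jN cj yp]]] xy] <-].
  exists (Ordinal jN) => //; exists x => //; exists p => // i /=.
  have hj := le_trans hd (dN j jN).
  have := xy i; have /andP[] := yp i; rewrite ler_norml => ? ? /andP[? ?].
  by apply/andP; split; lra.
have [fT cT] := ncard_bigcup (fun j => (UP j).1) SU.
split=> //.
apply: (@le_trans _ _ ((\sum_(j < N) w j)%R)%:E).
  rewrite lee_fin; apply: (@le_trans _ _ (\sum_(j < N) gridvol h (U j))%R).
    rewrite /gridvol -mulr_sumr ler_pM2l ?exprn_gt0 // -natr_sum ler_nat //.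
  by apply: ler_sum => j _; case: (UP j).
apply: (@le_trans _ _ (\sum_(0 <= j <oo) (obox_vol (c j))%:E + (e / 2)%:E)); last first.
  rewrite [in leRHS](splitr e) EFinD addeA leeD2r //; exact: ltW.
apply: le_trans (epsilon_trick _ _ (ltW e20)); last first.
  by move=> n; rewrite lee_fin obox_vol_ge0.
rewrite -sumEFin -(big_mkord xpredT (fun j => (w j)%:E)).
apply: nneseries_lim_ge => n _ _; rewrite lee_fin addr_ge0 ?obox_vol_ge0 //.
by rewrite divr_ge0 // ltW.
Qed.

End Outer.

(** * Volume of compact sets *)

Section Compact.
Variable R : realType.

Lemma compact_image_continuous (T U : topologicalType) (f : T -> U) (A : set T) :
  continuous f -> compact A -> compact (f @` A).
Proof. by move=> cf; apply: continuous_compact; exact: continuous_subspaceT. Qed.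

Lemma compact_mulmxr m n (F : 'M[R]_(m, n)) (S : set 'rV[R]_m) :
  compact S -> compact [set x *m F | x in S].
Proof.
apply: compact_image_continuous.
rewrite (_ : mulmx^~ F = fun y => \sum_i y 0 i *: row i F); last first.
  by apply/funext => y; rewrite mulmx_sum_row.
move=> x; apply: cvg_big; [exact: add_continuous|exact: nbhs_filter|move=> i _].
apply: (@cvgZr_tmp _ _ _ _ _ (fun y : 'rV[R]_m => y 0 i)).
  exact: nbhs_filter.
exact: (@coord_continuous R 1 m 0 i x).
Qed.

Lemma compact_scale n (s : R) (S : set 'rV[R]_n) :
  compact S -> compact [set s *: x | x in S].
Proof.
move=> cS; have := @compact_mulmxr n n s%:M S cS.
by under eq_imagel do rewrite mul_mx_scalar.
Qed.

Lemma compact_minksum n (A B : set 'rV[R]_n) :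
  compact A -> compact B -> compact (minksum A B).
Proof.
move=> cA cB; have -> : minksum A B = (fun p => p.1 + p.2) @` (A `*` B).
  apply/seteqP; split=> [x [a [b [Aa [Bb ->]]]]|_ [[a b] [Aa Bb] <-]].
    by exists (a, b).
  by exists a, b.
by apply: compact_image_continuous; [exact: add_continuous|exact: compact_setX].
Qed.

Lemma compact_coord_bounded n (S : set 'rV[R]_n) : compact S ->
  exists2 M, 0 < M & forall x, S x -> forall i, `|x 0 i| <= M.
Proof.
move=> /compact_bounded [M [_ H]].
exists (Num.max M 0 + 1); first by rewrite ltr_wpDl // le_max lexx orbT.
move=> x Sx i; have : `|x| <= Num.max M 0 + 1.
  by apply: (H _ _ x Sx); rewrite ltr_pwDr // le_max lexx.
apply: le_trans; rewrite [leRHS]mx_normrE.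
exact: (le_bigmax _ (fun ij => `|x ij.1 ij.2|) (0, i)).
Qed.

(** The difference set [S - T] is compact, hence closed, and misses 0; so it misses a whole ball
    around 0. *)
Lemma compact_disjoint_dist n (S T : set 'rV[R]_n) : compact S -> compact T ->
  S `&` T = set0 ->
  exists2 d, 0 < d & forall x y, S x -> T y -> exists i, d <= `|x 0 i - y 0 i|.
Proof.
move=> cS cT ST0.
have cD := compact_minksum cS (@compact_scale n (-1) T cT).
have := compact_closed (@norm_hausdorff _ _) cD => /closed_openC.
rewrite openE => /(_ 0) D0.
have /D0 /nbhs_ballP [e e0 He] : (~` minksum S [set -1 *: x | x in T]) 0.
  move=> [a [_ [Sa [[b Tb <-] /eqP]]]]; rewrite scaleN1r eq_sym subr_eq0 => /eqP ab.
  have : (S `&` T) a by split=> //; rewrite ab.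
  by rewrite ST0.
exists e => // x y Sx Ty.
apply: contrapT => H; apply: (He (x - y)); last first.
  by exists x, (- y); split=> //; split=> //; exists y => //; rewrite scaleN1r.
split=> // i j; rewrite ord1 !mxE /ball /= sub0r normrN ltNge.
by apply/negP => exy; apply: H; exists j.
Qed.

End Compact.

(** * Real-valued volume: grid limits, additivity, translation and scaling *)

Section Volume.
Variable R : realType.

(** [fine] turns an infinite value into 0; compact sets have finite outer measure by
    [outer_fin_num]. *)
Definition rvol k (S : set 'rV[R]_k) : R := fine (lebesgue_outer S).

Lemma compact_finite_cell k (h : R) (S : set 'rV[R]_k) :
  compact S -> 0 < h -> finite_set (cell h @` S).
Proof.
move=> /compact_coord_bounded [M M0 SM] h0.
apply: (@gridvol_box R k h (fun=> - M) (fun=> 2 * M) S h0 _ _).1 => [_|x Sx i].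
  by rewrite mulr_ge0 // ltW.
by have := SM x Sx i; rewrite ler_norml => /andP[? ?]; apply/andP; split; lra.
Qed.

Lemma outer_fin_num k (S : set 'rV[R]_k) : compact S ->
  lebesgue_outer S \is a fin_num.
Proof.
move=> cS; rewrite ge0_fin_numE ?outer_ge0 //.
by apply: le_lt_trans (outer_le_gridvol ltr01 (compact_finite_cell cS ltr01)) (ltry _).
Qed.

Lemma outerE k (S : set 'rV[R]_k) : compact S -> lebesgue_outer S = (rvol S)%:E.
Proof. by move=> cS; rewrite fineK // outer_fin_num. Qed.

Lemma rvol_ge0 k (S : set 'rV[R]_k) : 0 <= rvol S.
Proof. by rewrite fine_ge0 // outer_ge0. Qed.

Lemma rvol_le_gridvol k (h : R) (S : set 'rV[R]_k) : compact S -> 0 < h ->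
  rvol S <= gridvol h S.
Proof.
move=> cS h0; rewrite -lee_fin -outerE //.
exact: outer_le_gridvol (compact_finite_cell cS h0).
Qed.

Lemma thicken_sub k (h : R) (S : set 'rV[R]_k) : 0 <= h -> S `<=` thicken h S.
Proof. by move=> h0 x Sx; exists x => // i; rewrite subrr normr0. Qed.

Lemma near_small (t d : R) : 0 < t -> 0 < d -> \forall M \near \oo,
  0 < t / M.+1%:R <= d.
Proof.
move=> t0 d0; have dt : 0 < d / t by rewrite divr_gt0.
have := near_infty_natSinv_lt (PosNum dt); apply: filterS => M /= MH.
by rewrite divr_gt0 ?ltr0Sn //= mulrC -ler_pdivlMr // ltW.
Qed.

(** [outer_le_gridvol] bounds from one side and [gridvol_thicken_le] from the other. Steps of the
    form [t / M.+1] make a prescribed length [t] a multiple of every step. *)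
Lemma gridvol_cvg k (t : R) (S : set 'rV[R]_k) : compact S -> 0 < t ->
  gridvol (t / M.+1%:R) S @[M --> \oo] --> rvol S.
Proof.
move=> cS t0; apply/cvgrPdist_le => e e0.
have [d d0 dP] := gridvol_thicken_le cS e0 (outer_fin_num cS).
apply: filterS (near_small t0 d0) => M hd.
have [f1 c1] := dP _ hd; case/andP: hd => h0 _.
rewrite distrC ger0_norm ?subr_ge0 ?rvol_le_gridvol // lerBlDl.
move: c1; rewrite outerE // -EFinD lee_fin; apply: le_trans.
rewrite ler_pM2l ?exprn_gt0 // ler_nat leq_ncard //.
exact: image_subset (thicken_sub (ltW h0)).
Qed.

(** Upper semicontinuity of the volume, which closes the final limit argument. *)
Lemma rvol_thicken k (S : set 'rV[R]_k) (e : R) : compact S -> 0 < e ->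
  exists2 d, 0 < d & forall T, compact T -> T `<=` thicken d S ->
    rvol T <= rvol S + e.
Proof.
move=> cS e0; have [d d0 dP] := gridvol_thicken_le cS e0 (outer_fin_num cS).
exists d => // T cT TS; have [|f1 c1] := dP d; first by rewrite d0 lexx.
rewrite -lee_fin EFinD -!outerE //; apply: le_trans c1.
exact: le_trans (le_outer TS) (outer_le_gridvol d0 f1).
Qed.

Lemma le_rvol k (S T : set 'rV[R]_k) : compact T -> compact S ->
  S `<=` T -> rvol S <= rvol T.
Proof. by move=> cT cS ST; rewrite -lee_fin -!outerE // le_outer. Qed.

Lemma cell_dist k (h : R) (x y : 'rV[R]_k) i : 0 < h ->
  cell h y = cell h x -> `|x 0 i - y 0 i| < h.
Proof.
move=> h0 /(cellP y _ h0) /(_ i) yz.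
have /(cellP x _ h0) /(_ i) := erefl (cell h x); move: yz.
by rewrite ltr_norml => /andP[? ?] /andP[? ?]; apply/andP; split; lra.
Qed.

Let gridvolD_cvg k (S T : set 'rV[R]_k) : compact S -> compact T ->
  gridvol (1 / M.+1%:R) S + gridvol (1 / M.+1%:R) T @[M --> \oo]
    --> rvol S + rvol T.
Proof. by move=> cS cT; apply: cvgD; exact: gridvol_cvg. Qed.

Lemma rvolU_le k (S T : set 'rV[R]_k) : compact S -> compact T ->
  rvol (S `|` T) <= rvol S + rvol T.
Proof.
move=> cS cT.
apply: (ler_cvg_to (gridvol_cvg (compactU cS cT) ltr01) (gridvolD_cvg cS cT)).
near=> M; rewrite /gridvol -mulrDr image_setU -natrD /=.
rewrite ler_pM2l ?exprn_gt0 ?divr_gt0 ?ltr0Sn // ler_nat.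
by apply: ncardU_le; apply: compact_finite_cell => //; rewrite divr_gt0 ?ltr0Sn.
Unshelve. all: by end_near. Qed.

(** Once the step is below the distance between the two sets, no cell meets both and the counts
    add. *)
Lemma rvolU k (S T : set 'rV[R]_k) : compact S -> compact T -> S `&` T = set0 ->
  rvol S + rvol T <= rvol (S `|` T).
Proof.
move=> cS cT ST0; have [d d0 dP] := compact_disjoint_dist cS cT ST0.
apply: (ler_cvg_to (gridvolD_cvg cS cT) (gridvol_cvg (compactU cS cT) ltr01)).
apply: filterS (near_small ltr01 d0) => M /andP[h0 hd].
rewrite /= /gridvol -mulrDr image_setU -natrD ncardU //.
- exact: compact_finite_cell.
- exact: compact_finite_cell.
apply/seteqP; split=> // z [[x Sx <-] [y Ty yx]].
have [i] := dP x y Sx Ty; rewrite leNgt; case/negP; apply: lt_le_trans hd.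
exact: cell_dist.
Qed.

Lemma outer_translate_le k (a : 'rV[R]_k) (S : set 'rV[R]_k) :
  (lebesgue_outer [set (x + a)%R | x in S] <= lebesgue_outer S)%E.
Proof.
apply: ereal_inf_le_tmp => _ [c Sc <-].
exists (fun j => omap (fun p => (p.1 + a, p.2 + a)) (c j)).
  move=> _ [x Sx <-]; have [j _ xj] := Sc x Sx; exists j => //.
  by case: (c j) xj => [p|] //= H i; rewrite !mxE !lerD2r.
apply: eq_eseriesr => j _; case: (c j) => [p|] //=; congr EFin.
by apply: eq_bigr => i _; rewrite !mxE opprD addrACA subrr addr0.
Qed.

Lemma rvol_translate k (a : 'rV[R]_k) (S : set 'rV[R]_k) :
  rvol [set x + a | x in S] = rvol S.
Proof.
congr fine; apply/eqP; rewrite eq_le outer_translate_le /=.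
have {1}-> : S = [set x + - a | x in [set x + a | x in S]].
  rewrite image_comp; apply/seteqP; split=> [x Sx|_ [x Sx <-]] /=.
    by exists x => //=; rewrite addrK.
  by rewrite addrK.
exact: outer_translate_le.
Qed.

(** Dilation by [s] carries the grid of step [1 / M.+1] to that of step [s / M.+1] and preserves the
    count of cells met. *)
Lemma rvol_scale k (s : R) (S : set 'rV[R]_k) : compact S -> 0 < s ->
  rvol [set s *: x | x in S] = s ^+ k * rvol S.
Proof.
move=> cS s0.
apply: (cvg_unique (@norm_hausdorff _ _) (gridvol_cvg (@compact_scale R k s S cS) s0)).
suff -> : (fun M : nat => gridvol (s / M.+1%:R) [set s *: x | x in S]) =
    (fun M : nat => s ^+ k * gridvol (1 / M.+1%:R) S).
  by apply: cvgMl_tmp; exact: gridvol_cvg.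
apply/funext => M; rewrite /gridvol image_comp mulrA -exprMn mul1r.
congr (_ * (ncard _)%:R); apply: eq_imagel => x _ /=.
apply/rowP => i; rewrite !mxE; congr Num.floor.
have m0 : M.+1%:R != 0 :> R by rewrite pnatr_eq0.
by move: (M.+1%:R) m0 => m m0; field; rewrite m0 lt0r_neq0.
Qed.

End Volume.

(** * Minkowski sums with segments *)

Section Segments.
Variable R : realType.

Lemma segment0P n (v x : 'rV[R]_n) (t : R) : 0 <= t ->
  segment 0 (t *: v) x <-> exists2 r, 0 <= r <= t & x = r *: v.
Proof.
move=> t0; split=> [[s [/andP[s0 s1] ->]]|[r /andP[r0 rt] ->]].
  exists (s * t); first by rewrite mulr_ge0 //= ler_piMl.
  by rewrite scaler0 add0r scalerA.
move: rt; have [->|tn0] := eqVneq t 0 => rt.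
  have -> : r = 0 by apply/eqP; rewrite eq_le r0 rt.
  by exists 0; rewrite lexx ler01 scale0r !scaler0 addr0.
exists (r / t); rewrite divr_ge0 //= scaler0 add0r scalerA divfK //.
by rewrite ler_pdivrMr ?mul1r // lt_neqAle eq_sym tn0.
Qed.

Lemma segment0D n (v : 'rV[R]_n) (s t : R) : 0 <= s -> 0 <= t ->
  minksum (segment 0 (s *: v)) (segment 0 (t *: v)) = segment 0 ((s + t) *: v).
Proof.
move=> s0 t0; apply/seteqP; split=> x.
  move=> [y [z [/(segment0P _ _ s0)[a /andP[a0 a1] ->]]]].
  move=> [/(segment0P _ _ t0)[b /andP[b0 b1] ->] ->].
  apply/segment0P; first exact: addr_ge0.
  by exists (a + b); rewrite ?scalerDl // addr_ge0 //= lerD.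
move=> /(segment0P _ _ (addr_ge0 s0 t0))[r /andP[r0 r1] ->].
have [rs|sr] := leP r s.
  exists (r *: v), 0; rewrite addr0; split.
    by apply/segment0P => //; exists r; rewrite ?r0.
  by split=> //; apply/segment0P => //; exists 0; rewrite ?lexx ?scale0r.
exists (s *: v), ((r - s) *: v); rewrite -scalerDl [s + _]addrC subrK.
split; first by apply/segment0P => //; exists s; rewrite ?s0 ?lexx.
split=> //; apply/segment0P => //; exists (r - s) => //.
by rewrite subr_ge0 ltW //= lerBlDl.
Qed.

Lemma minksumA n (A B C : set 'rV[R]_n) :
  minksum (minksum A B) C = minksum A (minksum B C).
Proof.
apply/seteqP; split=> x.
  move=> [_ [c [[a [b [Aa [Bb ->]]]] [Cc ->]]]].
  by exists a, (b + c); rewrite addrA; do !split=> //; exists b, c.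
move=> [a [_ [Aa [[b [c [Bb [Cc ->]]]] ->]]]].
by exists (a + b), c; rewrite addrA; do !split=> //; exists a, b.
Qed.

Lemma minksumC n (A B : set 'rV[R]_n) : minksum A B = minksum B A.
Proof.
by apply/seteqP; split=> _ [a [b [Aa [Bb ->]]]]; exists b, a; rewrite addrC.
Qed.

Lemma minksum0 n (A : set 'rV[R]_n) : minksum A [set 0] = A.
Proof.
apply/seteqP; split=> x; first by move=> [a [b [Aa [-> ->]]]]; rewrite addr0.
by move=> Ax; exists x, 0; rewrite addr0.
Qed.

Lemma minksum_set1 n (A : set 'rV[R]_n) a : minksum A [set a] = [set x + a | x in A].
Proof.
apply/seteqP; split=> x; first by move=> [b [c [Ab [-> ->]]]]; exists b.
by move=> [b Ab <-]; exists b, a.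
Qed.

Lemma segment_translate n (a b : 'rV[R]_n) :
  segment a b = minksum (segment 0 (b - a)) [set a].
Proof.
rewrite minksum_set1; apply/seteqP; split=> x.
  move=> [t [t01 ->]]; exists (t *: (b - a)); first by exists t; rewrite scaler0 add0r.
  by rewrite scalerBr scalerBl scale1r -addrA addrC [- _ + _]addrC.
move=> [_ [t [t01 ->]] <-]; exists t; split=> //.
by rewrite scaler0 add0r scalerBr scalerBl scale1r -addrA addrC [- _ + _]addrC.
Qed.

Lemma compact_segment n (a b : 'rV[R]_n) : compact (segment a b).
Proof.
have -> : segment a b = (fun t : R => (1 - t) *: a + t *: b) @` `[0, 1]%classic.
  apply/seteqP; split=> x.
    by move=> [t [t01 ->]]; exists t => //; rewrite /= in_itv.
  by move=> [t]; rewrite /= in_itv /= => t01 <-; exists t.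
apply: compact_image_continuous; last exact: segment_compact.
move=> t; apply: cvgD; apply: cvgZr_tmp; last exact: cvg_id.
by apply: cvgB; [exact: cvg_cst|exact: cvg_id].
Qed.

Lemma convex_segment n (a b : 'rV[R]_n) : convex_set (segment a b).
Proof.
move=> _ _ [s [/andP[s0 s1] ->]] [t [/andP[t0 t1] ->]] r /andP[r0 r1].
exists (r * s + (1 - r) * t); split; first by apply/andP; split; nra.
rewrite !scalerDr !scalerA addrACA -!scalerDl; congr (_ *: _ + _ *: _).
by ring.
Qed.

Lemma convex_minksum n (A B : set 'rV[R]_n) :
  convex_set A -> convex_set B -> convex_set (minksum A B).
Proof.
move=> cA cB _ _ [a [b [Aa [Bb ->]]]] [a' [b' [Aa' [Bb' ->]]]] t t01.
exists (t *: a + (1 - t) *: a'), (t *: b + (1 - t) *: b').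
by split; [exact: cA|split; [exact: cB|rewrite !scalerDr addrACA]].
Qed.

Lemma convex_mulmxr m n (F : 'M[R]_(m, n)) (S : set 'rV[R]_m) :
  convex_set S -> convex_set [set x *m F | x in S].
Proof.
move=> cS _ _ [x Sx <-] [y Sy <-] t t01; exists (t *: x + (1 - t) *: y).
  exact: cS.
by rewrite mulmxDl -!scalemxAl.
Qed.

Lemma image_minksum m n (f : {additive 'rV[R]_m -> 'rV[R]_n}) (A B : set 'rV[R]_m) :
  f @` minksum A B = minksum (f @` A) (f @` B).
Proof.
apply/seteqP; split=> x.
  move=> [_ [a [b [Aa [Bb ->]]]] <-]; exists (f a), (f b).
  by rewrite raddfD; do !split.
move=> [_ [_ [[a Aa <-] [[b Bb <-] ->]]]]; exists (a + b); last by rewrite raddfD.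
by exists a, b.
Qed.

(** Half-open intervals, hence grid cells, are convex; the strict upper bound forces a separate
    treatment of [t = 0]. *)
Lemma convex_comb_itv (a b c d t : R) : 0 <= t <= 1 ->
  c <= a < d -> c <= b < d -> c <= t * a + (1 - t) * b < d.
Proof.
move=> /andP[t0 t1] /andP[ca ad] /andP[cb bd].
have := mulr_ge0 t0 (_ : 0 <= a - c); rewrite subr_ge0 => /(_ ca) h1.
have := mulr_ge0 (_ : 0 <= 1 - t) (_ : 0 <= b - c); rewrite !subr_ge0 => /(_ t1 cb) h2.
have h3 := mulr_ge0 (_ : 0 <= 1 - t) (_ : 0 <= d - b); rewrite !subr_ge0 in h3.
have {}h3 := h3 t1 (ltW bd).
apply/andP; split; first by lra.
move: t0; rewrite le_eqVlt => /orP[/eqP <-|t0]; first by lra.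
by have := mulr_gt0 t0 (_ : 0 < d - a); rewrite subr_gt0 => /(_ ad); lra.
Qed.

End Segments.

(** * Sums with a segment along the last axis, column by column *)

Section Column.
Variable R : realType.
Variable m : nat.
Implicit Types K : set 'rV[R]_(m + 1).

Let lst (T : Type) (x : 'rV[T]_(m + 1)) : T := x 0 (rshift m 0).

Let rowE (T : Type) (x y : 'rV[T]_(m + 1)) :
  lsubmx x = lsubmx y -> lst x = lst y -> x = y.
Proof.
move=> xy1 xy2; apply/rowP => i; rewrite -(splitK i).
case: (fintype.split i) => j /=; last by rewrite ord1.
by have /rowP /(_ j) := xy1; rewrite !mxE.
Qed.

Definition vlast : 'rV[R]_(m + 1) := row_mx 0 (const_mx 1).

Let lsub_vlast : lsubmx vlast = 0. Proof. exact: row_mxKl. Qed.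
Let lst_vlast : lst vlast = 1. Proof. by rewrite /lst row_mxEr mxE. Qed.
Let lst_cell h (x : 'rV[R]_(m + 1)) : lst (cell h x) = Num.floor (lst x / h).
Proof. by rewrite /lst mxE. Qed.
Let lsub_cell h (x : 'rV[R]_(m + 1)) : lsubmx (cell h x) = cell h (lsubmx x).
Proof. by apply/rowP => i; rewrite !mxE. Qed.

Let elast : 'rV[int]_(m + 1) := row_mx 0 (const_mx 1).
Let lsub_elast : lsubmx elast = 0. Proof. exact: row_mxKl. Qed.
Let lst_elast : lst elast = 1. Proof. by rewrite /lst row_mxEr mxE. Qed.
Let lstD (V : zmodType) (x y : 'rV[V]_(m + 1)) : lst (x + y) = lst x + lst y.
Proof. by rewrite /lst mxE. Qed.
Let lstN (V : zmodType) (x : 'rV[V]_(m + 1)) : lst (- x) = - lst x.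
Proof. by rewrite /lst mxE. Qed.
Let lstZ (a : R) (x : 'rV[R]_(m + 1)) : lst (a *: x) = a * lst x.
Proof. by rewrite /lst mxE. Qed.

(** If [z] is strictly below [w], the chord from a point of [K] in cell [z] to one in cell [z']
    crosses the bottom face of [w], which belongs to the half-open cell. It stays in the column
    because the column is convex. *)
Let column_contiguous h K (z z' w : 'rV[int]_(m + 1)) : 0 < h -> convex_set K ->
  (cell h @` K) z -> (cell h @` K) z' ->
  lsubmx z = lsubmx w -> lsubmx z' = lsubmx w -> lst z <= lst w <= lst z' ->
  (cell h @` K) w.
Proof.
move=> h0 cK Lz Lz' zw z'w /andP[]; rewrite le_eqVlt => /orP[/eqP zl _|zl z'l].
  by rewrite -(rowE zw zl).
have hn0 := lt0r_neq0 h0.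
have [x Kx xz] := Lz; have [y Ky yz] := Lz'.
have xl : lst x < (lst w)%:~R * h.
  have := floor_itv (lst x / h); rewrite -lst_cell xz => /andP[_].
  rewrite ltr_pdivrMr // => /lt_le_trans; apply.
  by rewrite ler_pM2r // ler_int; lia.
have yl : (lst w)%:~R * h <= lst y.
  have := floor_itv (lst y / h); rewrite -lst_cell yz => /andP[].
  rewrite ler_pdivlMr // => + _; apply: le_trans.
  by rewrite ler_pM2r // ler_int.
pose t := ((lst w)%:~R * h - lst x) / (lst y - lst x).
have d0 : 0 < lst y - lst x by rewrite subr_gt0; exact: lt_le_trans yl.
have t01 : 0 <= t <= 1.
  apply/andP; split; first by rewrite divr_ge0 ?subr_ge0 ?(ltW xl) // -subr_ge0 ltW.
  by rewrite ler_pdivrMr // mul1r lerD2r.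
exists (t *: y + (1 - t) *: x); first exact: cK.
apply: rowE; last first.
  rewrite lst_cell lstD !lstZ.
  have -> : t * lst y + (1 - t) * lst x = (lst w)%:~R * h.
    have tE : t * (lst y - lst x) = (lst w)%:~R * h - lst x by rewrite divfK ?lt0r_neq0.
    by move: tE; rewrite mulrBr mulrBl mul1r => ?; lra.
  by rewrite mulfK // intrKfloor.
rewrite lsub_cell; apply/cellP => // i.
have /(cellP _ _ h0) /(_ i) : cell h (lsubmx x) = lsubmx w by rewrite -lsub_cell xz.
have /(cellP _ _ h0) /(_ i) : cell h (lsubmx y) = lsubmx w by rewrite -lsub_cell yz.
by rewrite !mxE; exact: convex_comb_itv.
Qed.

(** A segment of length exactly [h] adds the cell above each cell met by [K]. Columns of a convex
    set have no gaps, so this is one new cell per column. *)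
Let column_step h K : 0 < h -> compact K -> convex_set K ->
  ncard (cell h @` minksum K (segment 0 (h *: vlast))) =
  (ncard (cell h @` K) + ncard (cell h @` (lsubmx @` K)))%N.
Proof.
move=> h0 cptK cK; have hn0 := lt0r_neq0 h0.
set L := cell h @` K; set L' := cell h @` _.
have fL : finite_set L by exact: compact_finite_cell.
have L'P z : L' z <-> L z \/ L (z - elast).
  split.
    move=> [_ [x [_ [Kx [/(segment0P _ _ (ltW h0))[r /andP[r0 rh] ->] ->]]] <-]].
    (* A move by at most [h] along the last axis raises the last index by 0 or 1 and keeps the
       others. *)
    have hx : cell h x = cell h (x + r *: vlast) \/
        cell h x = cell h (x + r *: vlast) - elast.
      have l1 : Num.floor (lst x / h) <= Num.floor ((lst x + r) / h).
        by apply: le_floor; rewrite ler_pM2r ?invr_gt0 // lerDl.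
      have l2 : Num.floor ((lst x + r) / h) <= Num.floor (lst x / h) + 1.
        rewrite -[1](@intrKfloor R) -floorDrz //; apply: le_floor.
        by rewrite mulrDl lerD2l ler_pdivrMr // mul1r.
      have [E|E] : Num.floor (lst x / h) = Num.floor ((lst x + r) / h) \/
          Num.floor (lst x / h) = Num.floor ((lst x + r) / h) - 1 by lia.
        left; apply: rowE; last by rewrite !lst_cell lstD lstZ lst_vlast mulr1.
        by rewrite !lsub_cell linearD linearZ /= lsub_vlast scaler0 addr0.
      right; apply: rowE; last first.
        by rewrite lstD lstN lst_elast !lst_cell lstD lstZ lst_vlast mulr1.
      rewrite linearB /= lsub_elast subr0 !lsub_cell.
      by rewrite linearD linearZ /= lsub_vlast scaler0 addr0.
    by case: hx => <-; [left|right]; exists x.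
  case=> [[x Kx <-]|[x Kx xz]].
    exists x => //; exists x, 0; rewrite addr0; do !split=> //.
    by apply/segment0P; [exact: ltW|exists 0; rewrite ?scale0r ?lexx ?ltW].
  exists (x + h *: vlast).
    exists x, (h *: vlast); do !split=> //.
    by apply/segment0P; [exact: ltW|exists h; rewrite ?lexx ?ltW].
  have -> : z = cell h x + elast by rewrite xz subrK.
  apply: rowE; last first.
    rewrite lstD lst_elast !lst_cell lstD lstZ lst_vlast mulr1 mulrDl divff //.
    by rewrite floorDrz // floor1.
  rewrite linearD /= lsub_elast addr0 !lsub_cell.
  by rewrite linearD linearZ /= lsub_vlast scaler0 addr0.
(* The topmost cells of each column of [L'], in bijection with the columns of [L]. *)
pose D := [set z | ~ L z /\ L (z - elast)].
have L'E : L' = L `|` D.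
  apply/seteqP; split=> z.
    by move=> /L'P [?|?]; [left|have [?|?] := pselect (L z); [left|right]].
  by case=> [?|[_ ?]]; apply/L'P; [left|right].
have fD : finite_set D.
  apply: (@sub_finite_set _ _ ((fun z => z + elast) @` L)); last exact: finite_image.
  by move=> z [_ Lz]; exists (z - elast) => //; rewrite subrK.
rewrite L'E ncardU //; last by apply/seteqP; split=> // z [Lz [/(_ Lz)]].
congr (_ + _)%N.
have -> : cell h @` (lsubmx @` K) = lsubmx @` L.
  by rewrite !image_comp; apply: eq_imagel => x _ /=; rewrite lsub_cell.
(* A column of [L] without a point of [D] would contain every cell above [z], which boundedness of
   [K] forbids. *)
have -> : lsubmx @` L = lsubmx @` D.
  apply/seteqP; split=> y; last first.
    move=> [z [_ Lz] <-]; exists (z - elast) => //.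
    by rewrite linearB /= lsub_elast subr0.
  move=> [z Lz <-]; apply: contrapT => ny.
  have Lzn (n : nat) : L (z + elast *+ n).
    elim: n => [|n IH]; first by rewrite addr0.
    apply: contrapT => nL; apply: ny; exists (z + elast *+ n.+1); last first.
      by rewrite linearD linearMn /= lsub_elast mul0rn addr0.
    by split=> //; rewrite mulrSr addrA addrK.
  have [M M0 KM] := compact_coord_bounded cptK.
  have lzn n : lst (z + elast *+ n) = lst z + n%:Z.
    by rewrite lstD; congr (_ + _); rewrite /lst mulmxnE -/(lst _) lst_elast -natz.
  have [x Kx] := Lzn `|(Num.floor (M / h) + 1 - lst z)%R|%N.
  move/(congr1 (@lst int)); rewrite lzn lst_cell => E.
  have : Num.floor (lst x / h) <= Num.floor (M / h).
    apply: le_floor; rewrite ler_pM2r ?invr_gt0 //.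
    by have := KM x Kx (rshift m 0); exact: le_trans (ler_norm _).
  by rewrite E; move: (lst z) (Num.floor (M / h)) => a b; lia.
rewrite ncard_image // => z z'; rewrite !inE => Dz Dz' zz'.
wlog lzz' : z z' Dz Dz' zz' / lst z <= lst z'.
  by move=> H; have /orP[/H->//|/H->//] := le_total (lst z) (lst z').
(* If [z] were strictly below [z'], it would lie between [z - elast] and [z' - elast], both in [L],
   and contiguity would put [z] in [L]. *)
apply: rowE => //; apply/eqP; rewrite eq_le lzz' /= leNgt; apply/negP => lt.
apply: Dz.1; apply: (column_contiguous h0 cK Dz.2 Dz'.2).
- by rewrite linearB /= lsub_elast subr0.
- by rewrite linearB /= lsub_elast subr0.
- move: lt; rewrite !lstD !lstN !lst_elast.
  by move: (lst z) (lst z') => a b; lia.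
Qed.

Let lsub_minksum_segment t K : 0 <= t ->
  lsubmx @` minksum K (segment 0 (t *: vlast)) = lsubmx @` K.
Proof.
move=> t0; apply/seteqP; split=> y; last first.
  move=> [x Kx <-]; exists x => //; exists x, 0; rewrite addr0; do !split=> //.
  by apply/segment0P => //; exists 0; rewrite ?lexx ?scale0r.
move=> [_ [x [_ [Kx [/(segment0P _ _ t0)[r _ ->] ->]]]] <-]; exists x => //.
by rewrite linearD linearZ /= lsub_vlast scaler0 addr0.
Qed.

Let gridvol_column h K N : 0 < h -> compact K -> convex_set K ->
  gridvol h (minksum K (segment 0 ((N%:R * h) *: vlast))) =
  gridvol h K + N%:R * h * gridvol h (lsubmx @` K).
Proof.
move=> h0 cptK cK.
suff E : ncard (cell h @` minksum K (segment 0 ((N%:R * h) *: vlast))) =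
    (ncard (cell h @` K) + N * ncard (cell h @` (lsubmx @` K)))%N.
  by rewrite /gridvol E natrD natrM exprD expr1; ring.
elim: N => [|N IH].
  rewrite mul0n addn0 mul0r scale0r; congr (ncard (cell h @` _)).
  rewrite -[RHS]minksum0; congr minksum; apply/seteqP; split=> x.
    by move=> [t [_ ->]]; rewrite !scaler0 addr0.
  by move=> ->; exists 0; rewrite lexx ler01 !scaler0 addr0.
have Nh : 0 <= N%:R * h by rewrite mulr_ge0 // ltW.
rewrite -natr1 mulrDl mul1r -segment0D // ?(ltW h0) // -minksumA.
rewrite column_step // ?lsub_minksum_segment // ?IH ?mulSn; first by lia.
- by apply: compact_minksum => //; exact: compact_segment.
- by apply: convex_minksum => //; exact: convex_segment.
Qed.

(** For the step [t / M.+1] the length [t] is exactly [M.+1] steps, so [gridvol_column] applies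
    without error term and passes to the limit. *)
Lemma rvol_column (t : R) K : 0 < t -> compact K -> convex_set K ->
  rvol (minksum K (segment 0 (t *: vlast))) = rvol K + t * rvol (lsubmx @` K).
Proof.
move=> t0 cptK cK.
have cs := compact_minksum cptK (@compact_segment _ _ 0 (t *: vlast)).
apply: (cvg_unique (@norm_hausdorff _ _) (gridvol_cvg cs t0)).
rewrite (_ : (fun M : nat => gridvol (t / M.+1%:R) _) =
    (fun M : nat => gridvol (t / M.+1%:R) K + t * gridvol (t / M.+1%:R) (lsubmx @` K))).
  apply: cvgD; first exact: gridvol_cvg.
  apply: cvgMl_tmp; apply: gridvol_cvg => //.
  have -> : lsubmx @` K = [set x *m col_mx 1%:M 0 | x in K].
    by apply: eq_imagel => x _; rewrite -{2}[x]hsubmxK mul_row_col mulmx1 mulmx0 addr0.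
  exact: compact_mulmxr.
apply/funext => M.
have h0 : 0 < t / M.+1%:R by rewrite divr_gt0 // ltr0Sn.
have := gridvol_column M.+1 h0 cptK cK.
by rewrite mulrCA divff ?mulr1 // pnatr_eq0.
Qed.

End Column.

(** * Rotation invariance *)

Section Rotation.
Variable R : realType.

Lemma rvol_set0 k : rvol (set0 : set 'rV[R]_k) = 0.
Proof.
apply/eqP; rewrite eq_le rvol_ge0 andbT.
apply: le_trans (rvol_le_gridvol (@compact0 _) ltr01) _.
by rewrite /gridvol image_set0 /ncard fset_set0 mulr0.
Qed.

Lemma rvol_bigU_le k (I : Type) (s : seq I) (C : I -> set 'rV[R]_k) :
  (forall i, compact (C i)) ->
  rvol (\big[setU/set0]_(i <- s) C i) <= \sum_(i <- s) rvol (C i).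
Proof.
move=> cC; elim: s => [|i s IH]; first by rewrite !big_nil rvol_set0.
rewrite !big_cons; apply: le_trans (rvolU_le _ _) _ => //.
  by apply: bigsetU_compact => j _; exact: cC.
by rewrite lerD2l.
Qed.

Lemma rvol_bigU k (I : eqType) (s : seq I) (C : I -> set 'rV[R]_k) :
  uniq s -> (forall i, compact (C i)) ->
  (forall i j x, C i x -> C j x -> i = j) ->
  \sum_(i <- s) rvol (C i) <= rvol (\big[setU/set0]_(i <- s) C i).
Proof.
move=> us cC dC; elim: s us => [|i s IH] /=; first by rewrite !big_nil rvol_ge0.
move=> /andP[si us]; rewrite !big_cons; apply: le_trans (rvolU _ _ _) => //.
- by rewrite lerD2l IH.
- by apply: bigsetU_compact => j _; exact: cC.
- apply/seteqP; split=> // x [Cx].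
  elim: s si {IH us} => [|j s IH]; first by rewrite big_nil.
  rewrite in_cons negb_or big_cons => /andP[ij si] [Cj|]; last exact: IH.
  by case/eqP: ij; exact: dC Cx Cj.
Qed.

Definition cube k : set 'rV[R]_k := [set x | forall i, 0 <= x 0 i <= 1].

Lemma compact_coord_itv k (a b : R) :
  compact [set x : 'rV[R]_k | forall i, a <= x 0 i <= b].
Proof.
have := @rV_compact R k (fun=> `[a, b]%classic) (fun=> @segment_compact _ _ _).
congr compact; apply/seteqP; split=> x H i; have := H i; by rewrite /= in_itv.
Qed.

Lemma compact_cube k : compact (@cube k).
Proof. exact: compact_coord_itv. Qed.

(** At step [1 / M.+1] the cube meets at least [M.+1 ^ k] cells, so its volume is even at least
    1. *)
Lemma rvol_cube_gt0 k : 0 < rvol (@cube k).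
Proof.
apply: (lt_le_trans ltr01).
apply: (ler_cvg_to (cvg_cst (1 : R)) (gridvol_cvg (@compact_cube k) ltr01)).
apply: nearW => M; rewrite /gridvol.
have M0 : M.+1%:R != 0 :> R by rewrite pnatr_eq0.
have h0 : 0 < 1 / M.+1%:R :> R by rewrite divr_gt0 ?ltr0Sn.
pose f (g : {ffun 'I_k -> 'I_M.+1}) : 'rV[int]_k := \row_i (g i : nat)%:Z.
have fI : injective f.
  move=> g g' /rowP E; apply/ffunP => i; apply/val_inj.
  by have := E i; rewrite !mxE => -[].
have fQ : range f `<=` cell (1 / M.+1%:R) @` @cube k.
  move=> _ [g _ <-]; exists (\row_i ((g i)%:R / M.+1%:R)).
    move=> i; rewrite mxE divr_ge0 //= ler_pdivrMr ?ltr0Sn // mul1r ler_nat.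
    exact: ltnW.
  apply/rowP => i; rewrite !mxE div1r invrK divfK //.
  by rewrite -[_%:R]/((g i : nat)%:Z%:~R) intrKfloor.
apply: (@le_trans _ _ ((1 / M.+1%:R) ^+ k * ((M.+1 ^ k)%N%:R) : R)).
  by rewrite natrX -exprMn divfK // expr1n.
rewrite ler_pM2l ?exprn_gt0 // ler_nat.
apply: leq_trans (leq_ncard (compact_finite_cell (@compact_cube k) h0) fQ).
rewrite ncard_image; last by move=> ? ? _ _; exact: fI.
  have -> : [set: {ffun 'I_k -> 'I_M.+1}] =
      [set` [fset x in {ffun 'I_k -> 'I_M.+1}]%fset].
    by apply/seteqP; split=> // x _; rewrite /= !inE.
  by rewrite /ncard set_fsetK card_finset card_ffun !card_ord.
exact: finite_finset.
Qed.

Lemma rvol_gt0 k (S : set 'rV[R]_k) (a : 'rV[R]_k) (r : R) : compact S -> 0 < r ->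
  (forall x : 'rV[R]_k, (forall i, `|x 0 i - a 0 i| <= r) -> S x) -> 0 < rvol S.
Proof.
move=> cS r0 aS.
have cQ := compact_scale (s := r) (@compact_cube k).
have : 0 < rvol [set x + a | x in [set r *: x | x in @cube k]].
  rewrite rvol_translate rvol_scale ?mulr_gt0 ?exprn_gt0 ?rvol_cube_gt0 //.
  exact: compact_cube.
move/lt_le_trans; apply; apply: le_rvol => //.
  by rewrite -minksum_set1; apply: compact_minksum => //; exact: compact_set1.
move=> _ [_ [x Qx <-] <-]; apply: aS => i; rewrite !mxE addrK.
have /andP[x0 x1] := Qx i; rewrite ger0_norm ?mulr_ge0 ?(ltW r0) //.
by rewrite ler_piMr // ltW.
Qed.

(** The image under [T] of the closed cell [z], first shrunk by [s] towards its lowest corner. *)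
Let subcube k (h s : R) (T : 'M[R]_k) (z : 'rV[int]_k) : set 'rV[R]_k :=
  [set x + (h *: map_mx intr z) *m T | x in [set (h * s) *: x | x in
    [set x *m T | x in @cube k]]].

Let compact_subcube k (h s : R) (T : 'M[R]_k) z : compact (subcube h s T z).
Proof.
rewrite /subcube -minksum_set1; apply: compact_minksum; last exact: compact_set1.
by apply/compact_scale/compact_mulmxr; exact: compact_cube.
Qed.

Let rvol_subcube k (h s : R) (T : 'M[R]_k) z : 0 < h -> 0 < s ->
  rvol (subcube h s T z) = (h * s) ^+ k * rvol [set x *m T | x in @cube k].
Proof.
move=> h0 s0; rewrite rvol_translate rvol_scale ?mulr_gt0 //.
by apply/compact_mulmxr; exact: compact_cube.
Qed.

(** Cover [S] by cells of step [h]: the image of each is a translate of the image of the unit cube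
    scaled by [h]. Then let [h] tend to 0. *)
Lemma rvol_mulmxr_le k (T : 'M[R]_k) (S : set 'rV[R]_k) : compact S ->
  rvol [set x *m T | x in S] <= rvol S * rvol [set x *m T | x in @cube k].
Proof.
move=> cS; set c := rvol [set x *m T | x in @cube k].
have cv : gridvol (1 / M.+1%:R) S * c @[M --> \oo] --> rvol S * c.
  by apply: cvgMr_tmp; exact: gridvol_cvg.
apply: (ler_cvg_to (cvg_cst (rvol [set x *m T | x in S])) cv).
apply: nearW => M; have h0 : 0 < 1 / M.+1%:R :> R by rewrite divr_gt0 ?ltr0Sn.
move: (1 / M.+1%:R) h0 => h h0.
have fS := compact_finite_cell cS h0.
set F := fset_set (cell h @` S).
apply: (@le_trans _ _ (rvol (\big[setU/set0]_(z <- F) subcube h 1 T z))).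
  apply: le_rvol; first by apply: bigsetU_compact => z _; exact: compact_subcube.
    exact: compact_mulmxr.
  move=> _ [x Sx <-]; rewrite -bigcup_seq; exists (cell h x).
    by rewrite /= in_fset_set // inE; exists x.
  exists ((x - h *: map_mx intr (cell h x)) *m T); last by rewrite mulmxBl subrK.
  exists ((h^-1 *: (x - h *: map_mx intr (cell h x))) *m T).
    exists (h^-1 *: (x - h *: map_mx intr (cell h x))) => // i.
    rewrite !mxE [_^-1 * _]mulrC divr_ge0 ?(ltW h0) //=.
    - rewrite ler_pdivrMr // mul1r lerBlDl.
      by have /(cellP x _ h0)/(_ i)/andP[_ /ltW] := erefl (cell h x); rewrite mxE mulrC.
    - rewrite subr_ge0.
      by have /(cellP x _ h0)/(_ i)/andP[+ _] := erefl (cell h x); rewrite mxE mulrC.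
  by rewrite mulr1 -scalemxAl scalerA divff ?scale1r // lt0r_neq0.
apply: le_trans (rvol_bigU_le _ (fun z => @compact_subcube _ h 1 T z)) _.
under eq_bigr do rewrite rvol_subcube // mulr1.
by rewrite big_const_seq count_predT iter_addr_0 -mulr_natr /gridvol mulrAC.
Qed.

Lemma dotvE n (x y : 'rV[R]_n) : dotv x y = (x *m y^T) 0 0.
Proof. by rewrite !mxE; apply: eq_bigr => i _; rewrite mxE. Qed.

Lemma coord_le_eball k (e : R) (x : 'rV[R]_k) i : 0 <= e -> eball e x ->
  `|x 0 i| <= e.
Proof.
move=> e0 xe; rewrite -(@ler_pXn2r _ 2) ?nnegrE // real_normK ?num_real //.
apply: le_trans xe; rewrite /dotv (bigD1 i) //= -expr2 lerDl.
by apply: sumr_ge0 => j _; rewrite -expr2 sqr_ge0.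
Qed.

Lemma compact_eball k (e : R) : 0 <= e -> compact (@eball R k e).
Proof.
move=> e0; apply: (subclosed_compact _ (@compact_coord_itv k (- e) e)).
  apply: (@preimage_closed _ _ (fun x : 'rV[R]_k => dotv x x) [set y | y <= e ^+ 2]).
    move=> x _; apply: cvg_big; [exact: add_continuous|exact: nbhs_filter|move=> i _].
    apply: (@cvgM _ _ (nbhs x) _ (fun y : 'rV[R]_k => y 0 i) (fun y => y 0 i));
      exact: (@coord_continuous R 1 k 0 i x).
  exact: closed_le.
by move=> x /coord_le_eball xe i; rewrite -ler_norml xe.
Qed.

Lemma convex_eball k (e : R) : convex_set (@eball R k e).
Proof.
move=> x y; rewrite /eball /= => xe ye t t01.
have dB : 0 <= dotv (x - y) (x - y).
  by apply: sumr_ge0 => j _; rewrite -expr2 sqr_ge0.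
have -> : dotv (t *: x + (1 - t) *: y) (t *: x + (1 - t) *: y) =
    t * dotv x x + (1 - t) * dotv y y - t * (1 - t) * dotv (x - y) (x - y).
  rewrite /dotv !mulr_sumr -big_split /= -sumrB; apply: eq_bigr => i _.
  by rewrite !mxE; ring.
case/andP: t01 => t0 t1; have t1' : 0 <= 1 - t by rewrite subr_ge0.
have := mulr_ge0 (mulr_ge0 t0 t1') dB.
by have := ler_wpM2l t0 xe; have := ler_wpM2l t1' ye; lra.
Qed.

(** * Orthogonal maps do not increase volume *)

Section Orthogonal.
Variables (k : nat) (T : 'M[R]_k).
Hypothesis TT : T *m T^T = 1%:M.

Let ball_inv : [set x *m T | x in @eball R k 1] = @eball R k 1.
Proof.
have dT U (x : 'rV[R]_k) : U *m U^T = 1%:M -> dotv (x *m U) (x *m U) = dotv x x.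
  by move=> UU; rewrite !dotvE trmx_mul mulmxA -(mulmxA x) UU mulmx1.
apply/seteqP; split=> [_ [x Dx <-]|x Dx]; first by rewrite /eball /= dT.
exists (x *m T^T); last by rewrite -mulmxA mulmx1C // mulmx1.
by rewrite /eball /= dT // trmxK; exact: mulmx1C.
Qed.

(** With this crude radius the sum of squares is at most [k r <= 1]; the radius is positive for
    [k = 0] too. *)
Let small_ball (r : R) (x : 'rV[R]_k) : r = k.+1%:R^-1 ->
  (forall i, `|x 0 i| <= r) -> eball 1 x.
Proof.
move=> rE xr; rewrite /eball /= expr1n.
have r0 : 0 < r by rewrite rE invr_gt0 ltr0Sn.
have r1 : r <= 1 by rewrite rE invf_le1 ?ltr0Sn // ler1n.
apply: (@le_trans _ _ (\sum_(i < k) r)).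
  apply: ler_sum => i _; rewrite -expr2 -real_normK ?num_real // expr2.
  rewrite -[leRHS]mulr1; apply: ler_pM => //; exact: le_trans (xr i) r1.
rewrite sumr_const card_ord -mulr_natr rE mulrC ler_pdivrMr ?ltr0Sn // mul1r.
by rewrite ler_nat.
Qed.

(* Pack slightly shrunken cells into the unit ball [D]: their images under the
   rotation are disjoint and still contained in [D], so that
   [(1 - e)^2k |T Q| |D| <= |D|]. *)
Let rvol_rot_cube_le1 : rvol [set x *m T | x in @cube k] <= 1.
Proof.
set c := rvol _; set D := @eball R k 1.
have cD : compact D by exact: compact_eball.
have D0 : 0 < rvol D.
  have k0 : (0 : R) < k.+1%:R^-1 by rewrite invr_gt0 ltr0Sn.
  apply: (@rvol_gt0 _ D 0 _ cD k0) => x xr; apply: small_ball => // i.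
  by have := xr i; rewrite mxE subr0.
(* Of the [k + k] factors, [k] come from shrinking the cells and [k] from shrinking the ball to
   [D']. *)
have H e : 0 < e -> e < 1 -> (1 - e) ^+ (k + k) * c <= 1.
  move=> e0 e1; have e'0 : 0 < 1 - e by rewrite subr_gt0.
  set D' := [set (1 - e) *: x | x in D].
  have cD' : compact D' by exact: compact_scale.
  suff : (1 - e) ^+ k * c * rvol D' <= rvol D.
    rewrite rvol_scale // mulrACA [_ * (c * _)]mulrA -exprD => H.
    by rewrite -(@ler_pM2r _ (rvol D)) // mul1r.
  have cv : (1 - e) ^+ k * c * gridvol (1 / M.+1%:R) D' @[M --> \oo] -->
      (1 - e) ^+ k * c * rvol D' by apply: cvgMl_tmp; exact: gridvol_cvg.
  apply: (ler_cvg_to cv (cvg_cst (rvol D))).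
  have er : 0 < e / k.+1%:R by rewrite divr_gt0 ?ltr0Sn.
  apply: filterS (near_small ltr01 er) => M.
  move: (1 / M.+1%:R) => h /andP[h0 hr].
  have fD := compact_finite_cell cD' h0.
  set F := fset_set (cell h @` D').
  (* Since [1 - e < 1], the shrunken closed cube stays in its half-open cell; the disjointness below
     rests on this. *)
  have cellE (z : 'rV[int]_k) (x : 'rV[R]_k) : cube x ->
      cell h ((h * (1 - e)) *: x + h *: map_mx intr z) = z.
    move=> Qx; apply/cellP => // i; rewrite !mxE.
    have /andP[x0 x1] := Qx i; rewrite [h * _%:~R]mulrC.
    have hx : 0 <= (1 - e) * x 0 i by rewrite mulr_ge0 // ltW.
    have hx1 : (1 - e) * x 0 i < 1.
      apply: le_lt_trans (_ : 1 - e < 1); last by rewrite gtrBl.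
      by rewrite ler_piMr // ltW.
    apply/andP; split; first by rewrite lerDr -mulrA mulr_ge0 // ltW.
    by rewrite [ltRHS]addrC ltrD2r -mulrA gtr_pMr.
  have -> : (1 - e) ^+ k * c * gridvol h D' =
      \sum_(z <- F) rvol (subcube h (1 - e) T z).
    under eq_bigr do rewrite rvol_subcube //.
    rewrite big_const_seq count_predT iter_addr_0 -mulr_natr /gridvol exprMn.
    by rewrite -/c mulrA [in RHS]mulrAC; ring.
  apply: (le_trans (rvol_bigU (fset_uniq F)
    (fun z => @compact_subcube _ h (1 - e) T z) _)).
    move=> z z' x [_ [_ [y Qy <-] <-] <-] [_ [_ [y' Qy' <-] <-]].
    rewrite !scalemxAl -!mulmxDl => /(congr1 (mulmx^~ T^T)) /=.
    rewrite -!mulmxA TT !mulmx1 => E.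
    by rewrite -(cellE z y) // -(cellE z' y') // E.
  apply: le_rvol => //; first by apply: bigsetU_compact => z _; exact: compact_subcube.
  rewrite -bigcup_seq => x [z /= zF [_ [_ [y Qy <-] <-] <-]].
  rewrite !scalemxAl -!mulmxDl /D -ball_inv.
  set w := _ + _; exists w => //.
  move: zF; rewrite in_fset_set // inE => -[_ [d Dd <-] dz].
  have wd i : `|w 0 i - ((1 - e) *: d) 0 i| < h.
    by apply: cell_dist => //; rewrite cellE // dz.
  (* [w] is a convex combination of [d] and [(w - (1 - e) d) / e]; the latter is in the ball because
     [h <= e / k.+1]. *)
  have -> : w = (1 - e) *: d + (1 - (1 - e)) *: (e^-1 *: (w - (1 - e) *: d)).
    by rewrite subKr scalerA divff ?scale1r ?lt0r_neq0 // addrC subrK.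
  apply: convex_eball => //; last by rewrite ltW //= gerBl ltW.
  apply: small_ball erefl _ => i.
  have := wd i; rewrite !mxE normrM ger0_norm ?invr_ge0 ?(ltW e0) // => /ltW wdi.
  by rewrite [leLHS]mulrC ler_pdivrMr // [leRHS]mulrC; exact: le_trans wdi hr.
have cv : (1 - e) ^+ (k + k) * c @[e --> 0^'+] --> (1 - 0) ^+ (k + k) * c.
  apply: cvgMr_tmp.
  have c1 : (1 - e) @[e --> 0^'+] --> (1 - 0 : R).
    by apply: cvgB; [exact: cvg_cst|exact/cvg_at_right_filter/cvg_id].
  elim: (k + k)%N => [|n IH]; first exact: cvg_cst.
  by rewrite exprS; under eq_fun do rewrite exprS; exact: cvgM.
rewrite subr0 expr1n mul1r in cv.
apply: (ler_cvg_to cv (cvg_cst (1 : R))).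
apply: filterS2 (nbhs_right_gt 0) (nbhs_right_lt ltr01) => e e0 e1; exact: H.
Qed.

Lemma rvol_rot_le (S : set 'rV[R]_k) : compact S ->
  rvol [set x *m T | x in S] <= rvol S.
Proof.
move=> cS; apply: le_trans (rvol_mulmxr_le T cS) _.
by rewrite ler_piMr ?rvol_rot_cube_le1 // rvol_ge0.
Qed.

End Orthogonal.

(** The reverse inequality is [rvol_rot_le] for the inverse map [T^T]. *)
Lemma rvol_rot k (T : 'M[R]_k) (S : set 'rV[R]_k) : T *m T^T = 1%:M -> compact S ->
  rvol [set x *m T | x in S] = rvol S.
Proof.
move=> TT cS; apply/eqP; rewrite eq_le rvol_rot_le //=.
have {1}-> : S = [set x *m T^T | x in [set x *m T | x in S]].
  rewrite image_comp; apply/seteqP; split=> [x Sx|_ [x Sx <-]] /=.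
    by exists x => //=; rewrite -mulmxA TT mulmx1.
  by rewrite -mulmxA TT mulmx1.
apply: rvol_rot_le; last exact: compact_mulmxr.
by rewrite trmxK; exact: mulmx1C.
Qed.

End Rotation.

(** * Frames, zonotopes and zonoids *)

Section Frames.
Variable R : realType.

Lemma dotv_ge0 k (x : 'rV[R]_k) : 0 <= dotv x x.
Proof. by apply: sumr_ge0 => i _; rewrite -expr2 sqr_ge0. Qed.

Lemma dotv_eq0 k (x : 'rV[R]_k) : (dotv x x == 0) = (x == 0).
Proof.
apply/idP/eqP => [|->]; last by rewrite dotvE mul0mx mxE.
rewrite /dotv psumr_eq0; last by move=> i _; rewrite -expr2 sqr_ge0.
move=> /allP xz; apply/rowP => i; have := xz i (mem_index_enum _).
by rewrite mulf_eq0 orbb mxE => /eqP.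
Qed.

(* Householder reflection along [w - e]. *)
Lemma reflection_exists k (w e : 'rV[R]_k) : dotv w w = 1 -> dotv e e = 1 ->
  exists2 H : 'M[R]_k, H *m H^T = 1%:M & w *m H = e.
Proof.
move=> ww ee; have [->|we] := eqVneq w e.
  by exists 1%:M; rewrite ?trmx1 mulmx1.
pose q := w - e; pose d := dotv q q.
have qq : q *m q^T = d%:M by rewrite [LHS]mx11_scalar -dotvE.
(* [w] and [e] have equal norms, so [|w - e|^2 = 2 <w, w - e>] and the reflection subtracts exactly
   [q] from [w]. *)
have dE : d = 2 * dotv w q.
  apply/eqP; rewrite -subr_eq0; apply/eqP.
  have : d - 2 * dotv w q = dotv e e - dotv w w; last by rewrite ee ww subrr.
  rewrite /d /dotv mulr_sumr -!sumrB.
  by apply: eq_bigr => i _; rewrite !mxE; ring.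
have d0 : d != 0 by rewrite dotv_eq0 subr_eq0.
have qe : w - q = e by rewrite subKr.
clearbody d; clearbody q; pose H := 1%:M - (2 / d) *: (q^T *m q).
have HT : H^T = H by rewrite /H linearB linearZ /= trmx1 trmx_mul trmxK.
exists H.
  have PP : (2 / d *: (q^T *m q)) *m (2 / d *: (q^T *m q)) =
      2 / d *: (q^T *m q) + 2 / d *: (q^T *m q).
    rewrite -scalemxAl -scalemxAr mulmxA -(mulmxA q^T q) qq mul_mx_scalar.
    by rewrite -scalemxAl !scalerA -scalerDl; congr (_ *: _); field.
  by rewrite HT /H mulmxBl mul1mx mulmxBr mulmx1 PP opprB addrK subrK.
rewrite /H mulmxBr mulmx1 -scalemxAr mulmxA [w *m q^T]mx11_scalar -dotvE.
rewrite mul_scalar_mx scalerA.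
have -> : 2 / d * dotv w q = 1 by rewrite mulrAC -dE divff.
by rewrite scale1r.
Qed.

(** [rvol (proj F K)] unfolds to [fine (projvol F K)], the quantity in the theorem. *)
Definition proj k n (F : 'M[R]_(k, n)) (K : set 'rV[R]_n) : set 'rV[R]_k :=
  [set x *m F^T | x in K].

Lemma compact_proj k n (F : 'M[R]_(k, n)) K : compact K -> compact (proj F K).
Proof. exact: compact_mulmxr. Qed.

Lemma proj_minksum k n (F : 'M[R]_(k, n)) K L :
  proj F (minksum K L) = minksum (proj F K) (proj F L).
Proof. exact: (image_minksum (mulmxr F^T)). Qed.

Lemma proj_segment0 k n (F : 'M[R]_(k, n)) v :
  proj F (segment 0 v) = segment 0 (v *m F^T).
Proof.
apply/seteqP; split=> [_ [_ [t [t01 ->]] <-]|_ [t [t01 ->]]].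
  by exists t; rewrite !scaler0 !add0r -scalemxAl.
by exists (t *: v); [exists t; rewrite scaler0 add0r|rewrite scaler0 add0r -scalemxAl].
Qed.

Lemma rvol_proj_segment k n (F : 'M[R]_(k, n)) K (a b : 'rV[R]_n) :
  rvol (proj F (minksum K (segment a b))) =
  rvol (minksum (proj F K) (segment 0 ((b - a) *m F^T))).
Proof.
rewrite segment_translate -minksumA proj_minksum.
have -> : proj F [set a] = [set a *m F^T] by rewrite /proj image_set1.
by rewrite minksum_set1 rvol_translate proj_minksum proj_segment0.
Qed.

Lemma orthonormal_rows_leq k n (F : 'M[R]_(k, n)) : orthonormal_rows F -> (k <= n)%N.
Proof.
move=> FF; rewrite -(mxrank1 R k) -FF.
exact: leq_trans (mxrankM_maxl _ _) (rank_leq_col _).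
Qed.

(** A rotation [H] of the coordinates turns the projection of [v] into [t] times the last axis, [t]
    being its length. The rows of [H^T *m F] are a new frame of the same subspace: [u] points along
    the projection of [v] and [G] spans the complement of [u], so [rvol_column] applies. *)
Lemma frame_along m n (F : 'M[R]_(m + 1, n)) (v : 'rV[R]_n) :
  orthonormal_rows F -> v *m F^T != 0 ->
  exists (G : 'M[R]_(m, n)) (u : 'rV[R]_n) (t : R),
  [/\ 0 < t, orthonormal_rows (col_mx G u), orthonormal_rows G,
    forall K, compact K -> rvol (proj (col_mx G u) K) = rvol (proj F K) &
    forall K, compact K -> convex_set K ->
      rvol (minksum (proj F K) (segment 0 (v *m F^T))) =
      rvol (proj F K) + t * rvol (proj G K)].
Proof.
move=> FF; set w := v *m F^T => w0.
have ww0 : 0 < dotv w w by rewrite lt_neqAle dotv_ge0 eq_sym dotv_eq0 w0.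
pose t := Num.sqrt (dotv w w).
have t0 : 0 < t by rewrite sqrtr_gt0.
have tn0 := lt0r_neq0 t0.
have [H HH wH] : exists2 H : 'M[R]_(m + 1),
    H *m H^T = 1%:M & (t^-1 *: w) *m H = vlast R m.
  apply: reflection_exists; rewrite dotvE.
    rewrite linearZ /= -scalemxAl -scalemxAr scalerA mxE -dotvE -invfM.
    by rewrite -expr2 sqr_sqrtr ?ltW // mulVf // lt0r_neq0.
  by rewrite /vlast tr_row_mx mul_row_col linear0 mulmx0 add0r !mxE big_ord1 !mxE mulr1.
have {}wH : w *m H = t *: vlast R m by rewrite -wH -scalemxAl scalerA divff // scale1r.
pose F' := H^T *m F; pose G := usubmx F'; pose u := dsubmx F'.
have F'E : F' = col_mx G u by rewrite vsubmxK.
have F'T : F'^T = F^T *m H by rewrite trmx_mul trmxK.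
have F'F : orthonormal_rows F'.
  rewrite /orthonormal_rows F'T -mulmxA (mulmxA F) FF mul1mx.
  exact: mulmx1C.
have projF' K : proj F' K = [set x *m H | x in proj F K].
  by rewrite /proj image_comp; apply: eq_imagel => x _; rewrite F'T mulmxA.
have projG K : lsubmx @` proj F' K = proj G K.
  rewrite /proj image_comp; apply: eq_imagel => x _ /=.
  by rewrite F'E tr_col_mx mul_mx_row row_mxKl.
exists G, u, t; split=> //.
- by rewrite -F'E.
- have := F'F; rewrite /orthonormal_rows F'E tr_col_mx mul_col_row.
  by rewrite scalar_mx_block => /eq_block_mx [].
- by move=> K cK; rewrite -F'E projF' rvol_rot //; exact: compact_proj.
move=> K cK vK; have cs := @compact_segment R _ 0 w.
rewrite -(rvol_rot HH); last by apply: compact_minksum => //; exact: compact_proj.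
have -> : [set x *m H | x in minksum (proj F K) (segment 0 w)] =
    minksum (proj F' K) (segment 0 (t *: vlast R m)).
  rewrite (image_minksum (mulmxr H)) /= -projF' -wH; congr minksum.
  by have := proj_segment0 H^T w; rewrite /proj trmxK.
rewrite rvol_column ?projG //; last 2 first.
- exact: compact_proj.
- exact: convex_mulmxr.
by rewrite projF' rvol_rot //; exact: compact_proj.
Qed.

Definition zonotope_of n (s : seq ('rV[R]_n * 'rV[R]_n)) : set 'rV[R]_n :=
  foldr (fun p S => minksum (segment p.1 p.2) S) [set 0] s.

Lemma compact_zonotope_of n (s : seq ('rV[R]_n * 'rV[R]_n)) : compact (zonotope_of s).
Proof.
elim: s => [|p s IH]; first exact: compact_set1.
by apply: compact_minksum => //; exact: compact_segment.
Qed.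

Lemma convex_zonotope_of n (s : seq ('rV[R]_n * 'rV[R]_n)) : convex_set (zonotope_of s).
Proof.
elim: s => [|p s IH]; last by apply: convex_minksum => //; exact: convex_segment.
by move=> x y -> -> t _; rewrite !scaler0 addr0.
Qed.

(** * The inequality for zonotopes, by induction on the segments *)

Section Ratio.
Variables (n : nat) (A C : set 'rV[R]_n).
Hypotheses (cA : compact A) (vA : convex_set A) (cC : compact C) (vC : convex_set C).
Hypothesis A_gt0 : forall k (F : 'M[R]_(k, n)), orthonormal_rows F -> 0 < rvol (proj F A).
Hypothesis C_gt0 : forall k (F : 'M[R]_(k, n)), orthonormal_rows F -> 0 < rvol (proj F C).
Hypothesis ratio : forall m (G : 'M[R]_(m, n)) (u : 'rV[R]_n),
  orthonormal_rows (col_mx G u) ->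
  rvol (proj (col_mx G u) A) * rvol (proj G C) <=
  rvol (proj (col_mx G u) C) * rvol (proj G A).

(** The induction on [s] keeps the frame general: one more segment calls for the previous case both
    in [F] and in the frame [G], one dimension lower. *)
Lemma zonotope_ratio (r : R) s k (F : 'M[R]_(k, n)) : 0 < r -> orthonormal_rows F ->
  rvol (proj F A) * rvol (proj F (minksum [set r *: x | x in C] (zonotope_of s))) <=
  rvol (proj F C) * rvol (proj F (minksum [set r *: x | x in A] (zonotope_of s))).
Proof.
move=> r0; elim: s k F => [|[a b] s IH] k F FF.
  rewrite /= !minksum0.
  have E K : proj F [set r *: x | x in K] = [set r *: x | x in proj F K].
    by rewrite /proj !image_comp; apply: eq_imagel => x _ /=; rewrite scalemxAl.
  rewrite !E !rvol_scale //; try exact: compact_proj.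
  by rewrite mulrCA [leRHS]mulrCA [rvol _ * rvol _]mulrC.
have E K : minksum K (zonotope_of ((a, b) :: s)) =
    minksum (minksum K (zonotope_of s)) (segment a b).
  by rewrite /= minksumA [minksum (segment _ _) _]minksumC.
have cK (K : set 'rV[R]_n) : compact K ->
    compact (minksum [set r *: x | x in K] (zonotope_of s)).
  by move=> ?; apply: compact_minksum; [exact: compact_scale|exact: compact_zonotope_of].
have vK (K : set 'rV[R]_n) : convex_set K ->
    convex_set (minksum [set r *: x | x in K] (zonotope_of s)).
  move=> vK; apply: convex_minksum; last exact: convex_zonotope_of.
  have := @convex_mulmxr R n n r%:M K vK.
  by under eq_imagel do rewrite mul_mx_scalar.
rewrite !E !rvol_proj_segment.
(* A segment orthogonal to the subspace projects to a point. This covers dimension 0 as well. *)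
have [->|] := eqVneq ((b - a) *m F^T) 0.
  have E0 (K : set 'rV[R]_k) : minksum K (segment 0 0) = K.
    rewrite -[RHS]minksum0; congr minksum; apply/seteqP; split=> x.
      by move=> [t [_ ->]]; rewrite !scaler0 addr0.
    by move=> ->; exists 0; rewrite lexx ler01 !scaler0 addr0.
  by rewrite !E0; exact: IH.
case: k F FF => [|m] F FF; first by rewrite [_ *m _]thinmx0 eqxx.
move: F FF; rewrite -addn1 => F FF w0.
have [G [u [t [t0 Gu GG FE GE]]]] := frame_along FF w0.
rewrite !GE //; try exact: cK; try exact: vK.
have IHF := IH _ F FF; have IHG := IH _ G GG.
have := ratio Gu; rewrite !FE //.
have := A_gt0 FF; have := C_gt0 FF; have := A_gt0 GG; have := C_gt0 GG.
move: IHF IHG; set X := minksum _ _; set Y := minksum _ _.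
have := rvol_ge0 (proj G X); have := rvol_ge0 (proj G Y).
move: (rvol (proj F A)) (rvol (proj F C)) (rvol (proj G A)) (rvol (proj G C))
  (rvol (proj F X)) (rvol (proj F Y)) (rvol (proj G X)) (rvol (proj G Y)).
move=> a1 c1 a2 c2 x y x' y' y'0 x'0 IHF IHG c20 a20 c10 a10 rt.
rewrite !mulrDr lerD // !(mulrCA _ t) ler_pM2l //.
(* [a2 x' <= c2 y'] by induction and [a1 c2 <= c1 a2] by the ratio hypothesis combine after
   multiplication by [a2 > 0]. *)
rewrite -(ler_pM2l a20) mulrCA; apply: le_trans (ler_wpM2l (ltW a10) IHG) _.
by rewrite mulrA [leRHS]mulrA [a2 * c1]mulrC ler_wpM2r.
Qed.

End Ratio.

(** * Interior cubes and dilations *)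

Lemma interior_coord_ball n (A : set 'rV[R]_n) : A° !=set0 ->
  exists (a : 'rV[R]_n) (r : R), 0 < r /\
    forall x : 'rV[R]_n, (forall i, `|x 0 i - a 0 i| <= r) -> A x.
Proof.
move=> [a /nbhs_ballP [r /= r0 ra]]; exists a, (r / 2); split; first by rewrite divr_gt0.
move=> x xa; apply: ra; split=> // i j; rewrite ord1 /ball /= distrC.
by apply: le_lt_trans (xa j) _; rewrite ltr_pdivrMr // ltr_pMr // ltr1n.
Qed.

(** A small cube around the projection of [a] lifts through [F] into the cube inside [A]. [M]
    dominates the absolute column sums of [F], and its summand 1 keeps it positive. *)
Lemma rvol_proj_gt0 k n (F : 'M[R]_(k, n)) (A : set 'rV[R]_n) (a : 'rV[R]_n) (r : R) :
  orthonormal_rows F -> compact A -> 0 < r ->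
  (forall x : 'rV[R]_n, (forall i, `|x 0 i - a 0 i| <= r) -> A x) ->
  0 < rvol (proj F A).
Proof.
move=> FF cA r0 aA; pose M := 1 + \sum_i \sum_j `|F i j|.
have M0 : 0 < M by rewrite ltr_pwDl // sumr_ge0 // => i _; exact: sumr_ge0.
have rM : 0 < r / M by rewrite divr_gt0.
apply: (rvol_gt0 (compact_proj cA) rM (a := a *m F^T)) => x xa.
exists (a + (x - a *m F^T) *m F); last first.
  by rewrite mulmxDl -mulmxA FF mulmx1 addrC subrK.
apply: aA => j; rewrite mxE addrAC subrr add0r mxE.
apply: le_trans (ler_norm_sum _ _ _) _.
apply: (@le_trans _ _ (\sum_i r / M * `|F i j|)).
  apply: ler_sum => i _; rewrite normrM ler_wpM2r //.
  by have := xa i; rewrite !mxE.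
rewrite -mulr_sumr mulrAC ler_pdivrMr // ler_pM2l //.
rewrite -[leLHS]add0r lerD // ler_sum // => i _.
by rewrite (bigD1 j) //= lerDl sumr_ge0.
Qed.

(* [K + d r B ⊆ (1 + d) K - d p] when [K] is convex and contains [p + r B]. *)
Lemma minksum_dilation n (K Y Z : set 'rV[R]_n) (p : 'rV[R]_n) (d r : R) :
  convex_set K -> 0 < d -> 0 < r ->
  (forall x : 'rV[R]_n, (forall i, `|x 0 i - p 0 i| <= r) -> K x) ->
  Z `<=` minksum Y (eball (d * r)) ->
  [set x + d *: p | x in minksum K Z] `<=`
    minksum [set (1 + d) *: x | x in K] Y.
Proof.
move=> vK d0 r0 pK ZY _ [_ [c [z [Kc [/ZY [y [b [Yy [bE ->]]]] ->]]]] <-].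
have d1 : 0 < 1 + d by rewrite addr_gt0.
have Kp : K (p + d^-1 *: b).
  apply: pK => i; rewrite !mxE addrAC subrr add0r normrM ger0_norm ?invr_ge0 ?(ltW d0) //.
  rewrite [leLHS]mulrC ler_pdivrMr // [leRHS]mulrC; apply: coord_le_eball bE.
  by rewrite mulr_ge0 // ltW.
have t01 : 0 <= (1 + d)^-1 <= 1.
  by rewrite invr_ge0 ltW //= invf_le1 // lerDl ltW.
(* [c + d p + b = (1 + d) (c / (1 + d) + (d / (1 + d)) (p + b / d))], where [p + b / d] is in [K]
   since [|b| <= d r]. *)
exists ((1 + d) *: ((1 + d)^-1 *: c + (1 - (1 + d)^-1) *: (p + d^-1 *: b))), y.
split; first by eexists; [exact: vK Kc Kp _ t01|].
split=> //; rewrite scalerDr !scalerA mulfV ?lt0r_neq0 // scale1r.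
have -> : (1 + d) * (1 - (1 + d)^-1) = d by rewrite mulrBr mulfV ?lt0r_neq0 //; ring.
rewrite scalerDr scalerA mulfV ?lt0r_neq0 // scale1r.
by rewrite -!addrA; congr (_ + _); rewrite addrCA [RHS]addrCA [y + _]addrC.
Qed.

End Frames.

(* A k-dimensional subspace E together with a unit vector u in E is given by
   an orthonormal frame col_mx G u (G : (k-1) x n), so that E = span(G, u)
   and E ∩ u^⊥ = span(G); here k = m.+1 with m < n. *)
Theorem theorem4p14 (R : realType) (n : nat) (A B : set 'rV[R]_n) :
  (1 <= n)%N ->
  convex_body A -> convex_body B ->
  (forall (m : nat) (G : 'M[R]_(m, n)) (u : 'rV[R]_n),
      (m < n)%N ->
      orthonormal_rows (col_mx G u) ->
      fine (projvol (col_mx G u) A) / fine (projvol G A)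
        <= fine (projvol (col_mx G u) (minksum A B)) / fine (projvol G (minksum A B))) ->
  forall Z : set 'rV[R]_n, zonoid Z ->
    (vol A * vol (minksum (minksum A B) Z) <= vol (minksum A B) * vol (minksum A Z))%E.
Proof.
move=> _ [cA [vA iA]] [cB [vB iB]] ratio Z [cZ [_ [Y [zY YZ]]]].
have [a [r [r0 aA]]] := interior_coord_ball iA.
have [b Bb] : B !=set0 by have [b /interior_subset Bb] := iB; exists b.
set C := minksum A B.
have cC : compact C by exact: compact_minksum.
have vC : convex_set C by exact: convex_minksum.
have aC (x : 'rV[R]_n) : (forall i, `|x 0 i - (a + b) 0 i| <= r) -> C x.
  move=> xab; exists (x - b), b; rewrite subrK; split=> //; apply: aA => i.
  by have := xab i; rewrite !mxE opprD addrA addrAC.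
have A_gt0 k (F : 'M[R]_(k, n)) : orthonormal_rows F -> 0 < rvol (proj F A).
  by move=> FF; exact: rvol_proj_gt0 aA.
have C_gt0 k (F : 'M[R]_(k, n)) : orthonormal_rows F -> 0 < rvol (proj F C).
  by move=> FF; exact: rvol_proj_gt0 aC.
(* The hypothesis cleared of its positive denominators; [m < n] follows from orthonormality. *)
have {}ratio m (G : 'M[R]_(m, n)) (u : 'rV[R]_n) : orthonormal_rows (col_mx G u) ->
    rvol (proj (col_mx G u) A) * rvol (proj G C) <=
    rvol (proj (col_mx G u) C) * rvol (proj G A).
  move=> Gu; have GG : orthonormal_rows G.
    have := Gu; rewrite /orthonormal_rows tr_col_mx mul_col_row.
    by rewrite scalar_mx_block => /eq_block_mx [].
  have mn : (m < n)%N by have := orthonormal_rows_leq Gu; rewrite addn1.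
  have := ratio m G u mn Gu.
  rewrite -/(rvol (proj (col_mx G u) A)) -/(rvol (proj G A)).
  rewrite -/(rvol (proj (col_mx G u) C)) -/(rvol (proj G C)).
  rewrite ler_pdivrMr ?A_gt0 // mulrAC ler_pdivlMr ?C_gt0 //.
have one_on : orthonormal_rows (1%:M : 'M[R]_n) by rewrite /orthonormal_rows trmx1 mulmx1.
(* The identity frame spans the whole space, where projections become the sets themselves. *)
have proj1 K : proj (1%:M : 'M[R]_n) K = K.
  rewrite /proj trmx1 -[RHS]image_id; apply: eq_imagel => x _; exact: mulmx1.
have cAZ : compact (minksum A Z) by exact: compact_minksum.
have cCZ : compact (minksum C Z) by exact: compact_minksum.
rewrite /vol !outerE // -!EFinM lee_fin.
have C0 : 0 < rvol C by rewrite -[C]proj1 C_gt0.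
apply/ler_addgt0Pr => eta eta0.
(* The error allowed on the volume of [A + Z] is [eta / rvol C], since it gets multiplied by
   [rvol C]. *)
have [d d0 dP] := rvol_thicken cAZ (divr_gt0 eta0 C0).
have [M M0 AM] := compact_coord_bounded cA.
(* Dilating [A] moves a coordinate by at most [dl M] and replacing the zonotope by [Z] by at most
   [dl r]; the total is [d]. *)
pose dl := d / (M + r).
have Mr0 : 0 < M + r by rewrite addr_gt0.
have dl0 : 0 < dl by rewrite divr_gt0.
have [N YN] := YZ (dl * r) (mulr_gt0 dl0 r0).
have [YZN ZYN] := YN N (leqnn N).
have [s Ys] := zY N; move: YZN ZYN; rewrite Ys -/(zonotope_of s) => YZN ZYN.
have dl1 : 0 < 1 + dl by rewrite addr_gt0.
have := zonotope_ratio cA vA cC vC A_gt0 C_gt0 ratio s dl1 one_on.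
rewrite !proj1 => H.
have cdil (K : set 'rV[R]_n) : compact K ->
    compact (minksum [set (1 + dl) *: x | x in K] (zonotope_of s)).
  by move=> cK; apply: compact_minksum; [exact: compact_scale|exact: compact_zonotope_of].
(* The translate of [C + Z] by [dl (a + b)], with [a + b] the centre of the cube in [C], fits into
   the dilated sum. *)
apply: (@le_trans _ _ (rvol A *
    rvol (minksum [set (1 + dl) *: x | x in C] (zonotope_of s)))).
  rewrite ler_wpM2l ?rvol_ge0 // -(rvol_translate (dl *: (a + b)) (minksum C Z)).
  apply: le_rvol; first exact: cdil.
    by rewrite -minksum_set1; apply: compact_minksum => //; exact: compact_set1.
  exact: minksum_dilation vC dl0 r0 aC ZYN.
apply: (le_trans H).
have -> : rvol C * rvol (minksum A Z) + eta =
    rvol C * (rvol (minksum A Z) + eta / rvol C).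
  by rewrite mulrDr [_ * (_ / _)]mulrC divfK ?lt0r_neq0.
rewrite ler_wpM2l ?rvol_ge0 //; apply: dP; first exact: cdil.
move=> _ [_ [y [[x Ax <-] [/YZN [z [e [Zz [eE ->]]]] ->]]]].
exists (x + z); first by exists x, z.
move=> i; rewrite !mxE mulrDl mul1r.
have -> : x 0 i + dl * x 0 i + (z 0 i + e 0 i) - (x 0 i + z 0 i) =
  dl * x 0 i + e 0 i by ring.
apply: le_trans (ler_normD _ _) _.
have -> : d = dl * M + dl * r by rewrite -mulrDr divfK // lt0r_neq0.
rewrite lerD //; last by apply: coord_le_eball eE; rewrite mulr_ge0 // ltW.
by rewrite normrM gtr0_norm // ler_pM2l // AM.
Qed.
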